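(* Let $a_x,a_y,c_x,c_y\in\mathbb R$, $\varepsilon_0>0$, and fix a finite Fourier grid, i.e. a finite set $\mathcal K\subset\mathbb R^2$ of wavenumbers $(\kappa_x,\kappa_y)$, for the periodic relaxation system $$u_t+v_x+q_y=0,\qquad v_t+a_x^2u_x=\frac{c_xu-v}{\varepsilon},\qquad q_t+a_y^2u_y=\frac{c_yu-q}{\varepsilon}.$$ Assume there is $\gamma_2>0$ such that $|\zeta_2(\varepsilon,i\kappa_x,i\kappa_y)|\ge\gamma_2$ for all $0\le\varepsilon\le\varepsilon_0$ and every $(\kappa_x,\kappa_y)\in\mathcal K$. Then the Fourier-semidiscrete SFRC solution is fourth-order accurate in time uniformly in $0<\varepsilon\le\varepsilon_0$ on that fixed grid: for every $T>0$ there are $h_0>0$ and $C_T>0$, independent of $\varepsilon$ and $h$ (but allowed to depend on the grid $\mathcal K$), such that for all $0<\varepsilon\le\varepsilon_0$, $0<h\le h_0$ and arbitrary Fourier initial data $(U^0_\kappa)_{\kappa\in\mathcal K}$, $U^0_\kappa\in\mathbb C^3$, $$\max_{0\le nh\le T}\Bigl(\sum_{\kappa\in\mathcal K}\bigl\|R_{{\rm SFRC},\kappa}(h,\varepsilon)^nU^0_\kappa-e^{nhL_{\varepsilon,\kappa}}U^0_\kappa\bigr\|^2\Bigr)^{1/2}\le C_Th^4\Bigl(\sum_{\kappa\in\mathcal K}\|U^0_\kappa\|^2\Bigr)^{1/2}.$$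
   Context: For a Fourier mode $\kappa=(\kappa_x,\kappa_y)$ put $(d_x,d_y)=(i\kappa_x,i\kappa_y)$ and, in the variables $(u,v,q)$, $$A=\begin{pmatrix}0&-d_x&-d_y\\-a_x^2d_x&0&0\\-a_y^2d_y&0&0\end{pmatrix},\quad B=\frac1\varepsilon\begin{pmatrix}0&0&0\\c_x&-1&0\\c_y&0&-1\end{pmatrix},\quad L_{\varepsilon,\kappa}=A+B.$$ Set $s=c_xd_x+c_yd_y$, $r=a_x^2d_x^2+a_y^2d_y^2$, and $\zeta_2(\varepsilon,d_x,d_y)=\sqrt{1-4\varepsilon s+4\varepsilon^2r}$ with $\operatorname{Re}\zeta_2\ge0$, continued in $\varepsilon$ from $\zeta_2=1$ at $\varepsilon=0$. The slow eigenvalue is $\lambda_s=2(\varepsilon r-s)/(1+\zeta_2)$, a root of $\varepsilon\lambda^2+\lambda+s-\varepsilon r=0$; it is a simple eigenvalue of $L_{\varepsilon,\kappa}$ under the stated condition. $\Pi_s$ is the rank-one spectral projector of $L_{\varepsilon,\kappa}$ for $\lambda_s$ and $\Pi_f=I-\Pi_s$. The SFRC one-step map is $$R_{{\rm SFRC},\kappa}(h,\varepsilon)=\Pi_sS(h;A,B)\Pi_s+e^{hL_{\varepsilon,\kappa}}\Pi_f,$$ where the base step is, with $L=A+B$, $$P_*=\Bigl(I-\tfrac h2B+\tfrac{h^2}{8}BL\Bigr)^{-1}\Bigl(I+\tfrac h2A+\tfrac{h^2}{8}AL\Bigr),$$ $$S(h;A,B)=\Bigl(I-hB+\tfrac{h^2}{6}BL\Bigr)^{-1}\Bigl[I+hA+\tfrac{h^2}{6}AL+\tfrac{h^2}{3}(A-B)LP_*\Bigr].$$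 The Fourier semidiscretization evolves each mode $\kappa\in\mathcal K$ independently by $U_t=L_{\varepsilon,\kappa}U$. Norms on $\mathbb C^3$ are Euclidean; $n$ ranges over nonnegative integers. *)

(* Defs.v *)
From HB Require Import structures.
From mathcomp Require Import all_boot all_order all_algebra.
From mathcomp Require Import finmap complex.
From mathcomp Require Import all_classical all_reals all_analysis.

Set Implicit Arguments.
Unset Strict Implicit.
Unset Printing Implicit Defensive.

Import Order.TTheory GRing.Theory Num.Theory numFieldNormedType.Exports.
Import ComplexField.

Local Open Scope classical_set_scope.
Local Open Scope complex_scope.
Local Open Scope ring_scope.

(* The limit is taken in the normed topology of complex matrices. *)
Definition expmx (R : realType) (n : nat) (M : 'M[R[i]]_n.+1) : 'M[R[i]]_n.+1 :=
  lim (series (fun k => (k`!%:R)^-1 *: M ^+ k) @ \oo).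

(* Spectral projector of M at a, M acting on column vectors: the projector onto
   ker (M - a)^(n+1) along im (M - a)^(n+1).  The subspaces of mxalgebra are
   row spaces, hence the transpositions. *)
Definition spectral_proj (F : fieldType) (n : nat) (M : 'M[F]_n.+1) (a : F) :
    'M[F]_n.+1 :=
  (proj_mx (geigenspace M^T a) ((M^T - a%:M) ^+ n.+1))^T.

Definition enorm (R : realType) (n : nat) (v : 'cV[R[i]]_n) : R :=
  Num.sqrt (\sum_i Normc.normc (v i 0) ^+ 2).

Definition grid_norm (R : realType) (n : nat) (K : {fset R * R})
    (U : R * R -> 'cV[R[i]]_n) : R :=
  Num.sqrt (\sum_(k <- K) enorm (U k) ^+ 2).

Definition mx3 (V : nmodType) (rows : seq (seq V)) : 'M[V]_3 :=
  \matrix_(i, j) nth 0 (nth [::] rows i) j.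

Definition matA (R : realType) (ax ay : R) (dx dy : R[i]) : 'M[R[i]]_3 :=
  mx3 [:: [:: 0; - dx; - dy];
          [:: - ((ax ^+ 2)%:C * dx); 0; 0];
          [:: - ((ay ^+ 2)%:C * dy); 0; 0]].

Definition matB (R : realType) (cx cy eps : R) : 'M[R[i]]_3 :=
  (eps^-1)%:C *: mx3 [:: [:: 0; 0; 0];
                         [:: cx%:C; -1; 0];
                         [:: cy%:C; 0; -1]].

Definition matL (R : realType) (ax ay cx cy eps : R) (dx dy : R[i]) :
    'M[R[i]]_3 :=
  matA ax ay dx dy + matB cx cy eps.

Definition sym_s (R : realType) (cx cy : R) (dx dy : R[i]) : R[i] :=
  cx%:C * dx + cy%:C * dy.

Definition sym_r (R : realType) (ax ay : R) (dx dy : R[i]) : R[i] :=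
  (ax ^+ 2)%:C * dx ^+ 2 + (ay ^+ 2)%:C * dy ^+ 2.

(* sqrtc is the square root with nonnegative real part (and nonnegative
   imaginary part on the negative real axis).  For imaginary dx, dy the
   radicand is 1 at eps = 0, has a nonzero constant-sign imaginary part for
   eps > 0 if s <> 0, and decreases along the real axis if s = 0.  So it can
   be a negative real at some eps only after vanishing at a smaller one; as
   long as zeta2 does not vanish on [0, eps0] this root is therefore the
   continuation in eps from zeta2 = 1 at eps = 0. *)
Definition zeta2 (R : realType) (ax ay cx cy eps : R) (dx dy : R[i]) : R[i] :=
  sqrtc (1 - 4 * eps%:C * sym_s cx cy dx dy
           + 4 * (eps ^+ 2)%:C * sym_r ax ay dx dy).

Definition lambda_s (R : realType) (ax ay cx cy eps : R) (dx dy : R[i]) :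
    R[i] :=
  2 * (eps%:C * sym_r ax ay dx dy - sym_s cx cy dx dy)
    / (1 + zeta2 ax ay cx cy eps dx dy).

Definition Proj_s (R : realType) (ax ay cx cy eps : R) (dx dy : R[i]) :
    'M[R[i]]_3 :=
  spectral_proj (matL ax ay cx cy eps dx dy) (lambda_s ax ay cx cy eps dx dy).

Definition Proj_f (R : realType) (ax ay cx cy eps : R) (dx dy : R[i]) :
    'M[R[i]]_3 :=
  1%:M - Proj_s ax ay cx cy eps dx dy.

Definition Pstar_den (R : realType) (n : nat) (h : R) (A B : 'M[R[i]]_n) :
    'M[R[i]]_n :=
  1%:M - (h / 2)%:C *: B + (h ^+ 2 / 8)%:C *: (B *m (A + B)).

Definition Pstar (R : realType) (n : nat) (h : R) (A B : 'M[R[i]]_n) :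
    'M[R[i]]_n :=
  invmx (Pstar_den h A B)
    *m (1%:M + (h / 2)%:C *: A + (h ^+ 2 / 8)%:C *: (A *m (A + B))).

Definition S_den (R : realType) (n : nat) (h : R) (A B : 'M[R[i]]_n) :
    'M[R[i]]_n :=
  1%:M - h%:C *: B + (h ^+ 2 / 6)%:C *: (B *m (A + B)).

Definition S_step (R : realType) (n : nat) (h : R) (A B : 'M[R[i]]_n) :
    'M[R[i]]_n :=
  invmx (S_den h A B)
    *m (1%:M + h%:C *: A + (h ^+ 2 / 6)%:C *: (A *m (A + B))
        + (h ^+ 2 / 3)%:C *: ((A - B) *m (A + B) *m Pstar h A B)).

Definition R_SFRC (R : realType) (ax ay cx cy h eps : R) (dx dy : R[i]) :
    'M[R[i]]_3 :=
  Proj_s ax ay cx cy eps dx dy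
    *m S_step h (matA ax ay dx dy) (matB cx cy eps)
    *m Proj_s ax ay cx cy eps dx dy
  + expmx (h%:C *: matL ax ay cx cy eps dx dy) *m Proj_f ax ay cx cy eps dx dy.

(* Fourier symbol i*k of a derivative. *)
Definition dsym (R : realType) (k : R) : R[i] := 0 +i* k.

(* Main.v *)
Require Import Defs.
From HB Require Import structures.
From mathcomp Require Import all_boot all_order all_algebra.
From mathcomp Require Import finmap complex.
From mathcomp Require Import all_classical all_reals all_analysis.
From mathcomp Require Import ring lra.

Set Implicit Arguments.
Unset Strict Implicit.
Unset Printing Implicit Defensive.

Import Order.TTheory GRing.Theory Num.Theory numFieldNormedType.Exports.
Import ComplexField.

Local Open Scope complex_scope.
Local Open Scope ring_scope.

(** A single mode.  Write [P] for the slow projector, [E] for the exact propagator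
over one step, [rho = exp (h lambda)] and [E P = P E = rho P].  Since [P] has rank one,
[P S P = sigma P] for a scalar [sigma], so the step is [sigma P + E (1 - P)] and

  [R ^ n - E ^ n = (sigma ^ n - rho ^ n) P].

The fast part is propagated exactly and contributes no error, whatever the
stiffness.  It remains to bound [P] and to show [|sigma - rho| <= C h^5], both
uniformly in [eps]; a telescoping sum then gives [h^4] on a bounded time interval
([power_error]), because [|sigma|] and [|rho|] are at most [exp (h k)] with [k]
independent of [eps].

The projector.  With [eta = 1 + eps lambda = (1 + zeta) / 2], the slow right and
left eigenvectors are [w = (eta, c - eps a)] and [l = (eta, - eps d)], with
[l w = eta zeta] ([slow_eigenvec], [Proj_s_outer]).  Everything in [w l / (l w)] is
bounded because [|eta| >= 1/2] and [|zeta| >= gamma].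

The local defect.  On an eigenvector, the implicit half step reproduces the Taylor
polynomial of degree two of [exp (h lambda / 2)] and the full step that of degree four
of [exp z], [z = h lambda], up to terms in [B w] ([Pstar_eigenvec],
[S_step_eigenvec]).  The vector [B w = lambda w - A w] is bounded, but one remaining
term carries [h^3 z^3 (A - B) L] applied to a resolvent, with two factors of order
[1/eps]; as a vector it is only [O (h^4)].
The missing power of [h] comes from pairing with [l], whose fast components are
[O (eps)].  To see this, only the rows [(1, 0, 0)] and [(0, d_x, d_y)] matter: they
span a space invariant under right multiplication by [A] and [B], so that the pairing
is an explicit rational function of [eps] and [h] ([slow_step]).  Its denominators
are [1 + h/eps + h^2 / (6 eps^2) - i t] and [1 + h/(2 eps) + h^2 / (8 eps^2) - i t'] with
[t], [t'] real, since [s] is imaginary; they are at least their real parts, which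
absorb every power of [h/eps] ([slow_defect_le]).

The matrix exponential.  It is handled through truncated sums: the functional
equation follows from that of the real exponential, which dominates the defect of
the truncated equation term by term ([exp_sum_mul], [expmxD]). *)

Local Notation normc := Normc.normc.

(** * Moduli and the entrywise l1 norm *)

Lemma normc_ge0 (R : realType) (z : R[i]) : 0 <= normc z.
Proof. by case: z => a b; exact: sqrtr_ge0. Qed.

Lemma normcD (R : realType) (x y : R[i]) : normc (x + y) <= normc x + normc y.
Proof. exact: le_normcD. Qed.

Lemma normcB (R : realType) (x y : R[i]) : normc (x - y) <= normc x + normc y.
Proof. by rewrite (le_trans (normcD _ _))// normcN. Qed.

Lemma normc_real (R : realType) (x : R) : normc x%:C = `|x|.
Proof. by rewrite /= expr0n /= addr0 sqrtr_sqr. Qed.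

Lemma normc_nat (R : realType) (n : nat) : normc (n%:R : R[i]) = n%:R.
Proof. by rewrite -(rmorph_nat (real_complex R)) normc_real ger0_norm. Qed.

Lemma normcX (R : realType) (z : R[i]) n : normc (z ^+ n) = normc z ^+ n.
Proof.
elim: n => [|n IHn]; first by rewrite !expr0 Normc.normc1.
by rewrite !exprS Normc.normcM IHn.
Qed.

Lemma normc_sum (R : realType) (I : Type) (r : seq I) (P : pred I)
    (F : I -> R[i]) :
  normc (\sum_(i <- r | P i) F i) <= \sum_(i <- r | P i) normc (F i).
Proof.
elim/big_ind2: _ => [|x a y b xa yb|//]; first by rewrite Normc.normc0.
by rewrite (le_trans (normcD _ _))// lerD.
Qed.

Lemma ler_Re_normc (R : realType) (z : R[i]) : `|complex.Re z| <= normc z.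
Proof.
by case: z => a b /=; rewrite -sqrtr_sqr ler_wsqrtr// lerDl sqr_ge0.
Qed.

Lemma ler_Im_normc (R : realType) (z : R[i]) : `|complex.Im z| <= normc z.
Proof.
by case: z => a b /=; rewrite -sqrtr_sqr ler_wsqrtr// lerDr sqr_ge0.
Qed.

Lemma normc_le_ReIm (R : realType) (z : R[i]) : normc z <= `|complex.Re z| + `|complex.Im z|.
Proof.
case: z => a b /=; rewrite -[leRHS]ger0_norm; last by rewrite addr_ge0.
rewrite -sqrtr_sqr ler_wsqrtr// sqrrD !real_normK ?num_real// addrAC lerDl.
by rewrite mulrn_wge0// mulr_ge0.
Qed.

(** Submultiplicative, unlike the maximum norm that defines the topology of matrices,
    and an upper bound for the Euclidean operator norm ([enorm_mul]). *)
Definition mxnorm1 (R : realType) m n (M : 'M[R[i]]_(m, n)) : R :=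
  \sum_i \sum_j normc (M i j).

Lemma mxnorm1_ge0 (R : realType) m n (M : 'M[R[i]]_(m, n)) : 0 <= mxnorm1 M.
Proof. by apply: sumr_ge0 => i _; apply: sumr_ge0 => j _; exact: normc_ge0. Qed.

Lemma mxnorm1_entry (R : realType) m n (M : 'M[R[i]]_(m, n)) i j :
  normc (M i j) <= mxnorm1 M.
Proof.
rewrite /mxnorm1 (bigD1 i)//= (bigD1 j)//= -addrA lerDl addr_ge0//.
  by apply: sumr_ge0 => *; exact: normc_ge0.
by apply: sumr_ge0 => ? _; apply: sumr_ge0 => *; exact: normc_ge0.
Qed.

Lemma mxnorm1_eq0 (R : realType) m n (M : 'M[R[i]]_(m, n)) :
  mxnorm1 M <= 0 -> M = 0.
Proof.
move=> M0; apply/matrixP => i j; rewrite mxE; apply: Normc.eq0_normc.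
apply/eqP; rewrite eq_le normc_ge0 andbT.
exact: le_trans (mxnorm1_entry M i j) M0.
Qed.

Lemma mxnorm1D (R : realType) m n (M N : 'M[R[i]]_(m, n)) :
  mxnorm1 (M + N) <= mxnorm1 M + mxnorm1 N.
Proof.
rewrite /mxnorm1 -big_split/=; apply: ler_sum => i _.
rewrite -big_split/=; apply: ler_sum => j _; rewrite mxE; exact: normcD.
Qed.

Lemma mxnorm1N (R : realType) m n (M : 'M[R[i]]_(m, n)) :
  mxnorm1 (- M) = mxnorm1 M.
Proof.
by apply: eq_bigr => i _; apply: eq_bigr => j _; rewrite mxE normcN.
Qed.

Lemma mxnorm1_0 (R : realType) m n : mxnorm1 (0 : 'M[R[i]]_(m, n)) = 0.
Proof.
by rewrite /mxnorm1 big1// => i _; rewrite big1// => j _; rewrite mxE Normc.normc0.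
Qed.

Lemma mxnorm1Z (R : realType) m n (a : R[i]) (M : 'M[R[i]]_(m, n)) :
  mxnorm1 (a *: M) = normc a * mxnorm1 M.
Proof.
rewrite /mxnorm1 mulr_sumr; apply: eq_bigr => i _.
by rewrite mulr_sumr; apply: eq_bigr => j _; rewrite mxE Normc.normcM.
Qed.

Lemma mxnorm1_sum (R : realType) m n (I : Type) (r : seq I) (P : pred I)
    (F : I -> 'M[R[i]]_(m, n)) :
  mxnorm1 (\sum_(i <- r | P i) F i) <= \sum_(i <- r | P i) mxnorm1 (F i).
Proof.
elim/big_ind2: _ => [|x a y b xa yb|//]; first by rewrite mxnorm1_0.
by rewrite (le_trans (mxnorm1D _ _))// lerD.
Qed.

Lemma mxnorm1M (R : realType) m n p (M : 'M[R[i]]_(m, n)) (N : 'M[R[i]]_(n, p)) :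
  mxnorm1 (M *m N) <= mxnorm1 M * mxnorm1 N.
Proof.
apply: (@le_trans _ _ (\sum_i \sum_j \sum_k normc (M i k) * normc (N k j))).
  apply: ler_sum => i _; apply: ler_sum => j _; rewrite mxE.
  by rewrite (le_trans (normc_sum _ _ _))//; apply: ler_sum => k _; rewrite Normc.normcM.
rewrite /mxnorm1 mulr_suml; apply: ler_sum => i _.
rewrite exchange_big mulr_suml; apply: ler_sum => k _ /=.
rewrite -mulr_sumr ler_wpM2l ?normc_ge0// [leRHS](bigD1 k)//= lerDl.
by apply: sumr_ge0 => ? _; apply: sumr_ge0 => *; exact: normc_ge0.
Qed.

Lemma mxnorm1X (R : realType) n (M : 'M[R[i]]_n.+1) k :
  mxnorm1 (M ^+ k.+1) <= mxnorm1 M ^+ k.+1.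
Proof.
elim: k => [|k IHk]; first by rewrite !expr1.
rewrite exprS [leRHS]exprS (le_trans (mxnorm1M _ _))//.
by rewrite ler_wpM2l ?mxnorm1_ge0.
Qed.

Lemma mxnorm1_col (R : realType) m (v : 'cV[R[i]]_m) :
  mxnorm1 v = \sum_i normc (v i 0).
Proof. by apply: eq_bigr => i _; rewrite big_ord1. Qed.

Lemma enorm_le_mxnorm1 (R : realType) m (v : 'cV[R[i]]_m) : enorm v <= mxnorm1 v.
Proof.
rewrite /enorm mxnorm1_col -[leRHS]ger0_norm; last first.
  by apply: sumr_ge0 => i _; exact: normc_ge0.
rewrite -sqrtr_sqr ler_wsqrtr// expr2 mulr_suml.
apply: ler_sum => i _; rewrite expr2 ler_wpM2l ?normc_ge0//.
rewrite (bigD1 i)//= lerDl; apply: sumr_ge0 => j _; exact: normc_ge0.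
Qed.

Lemma normc_le_enorm (R : realType) m (v : 'cV[R[i]]_m) i : normc (v i 0) <= enorm v.
Proof.
rewrite /enorm -[leLHS]ger0_norm ?normc_ge0// -sqrtr_sqr ler_wsqrtr//.
by rewrite (bigD1 i)//= lerDl; apply: sumr_ge0 => j _; exact: sqr_ge0.
Qed.

Lemma enorm_mul (R : realType) m n (M : 'M[R[i]]_(m, n)) (v : 'cV[R[i]]_n) :
  enorm (M *m v) <= mxnorm1 M * enorm v.
Proof.
rewrite (le_trans (enorm_le_mxnorm1 _))// mxnorm1_col /mxnorm1 mulr_suml.
apply: ler_sum => i _; rewrite mxE mulr_suml (le_trans (normc_sum _ _ _))//.
apply: ler_sum => j _; rewrite Normc.normcM ler_wpM2l ?normc_ge0//.
exact: normc_le_enorm.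
Qed.

(** * Truncated exponentials *)

(** Stated for any algebra, because the same identities are used for complex matrices
    and for the real numbers that bound their norms. *)
Definition exp_sum (F : unitRingType) (A : lalgType F) (N : nat) (x : A) : A :=
  \sum_(k < N) (k`!%:R : F)^-1 *: x ^+ k.

(** For commuting [x], [y] the product of two truncated sums ranges over the square
    [i, j < N], and the truncated sum of [x + y], by the binomial formula, over the
    triangle [i + j < N]; what is left is the complementary corner.  Its coefficients
    are nonnegative, so norms are bounded by the same corner over the reals. *)
Lemma exp_sum_mul (F : numFieldType) (A : algType F) (N : nat) (x y : A) :
  GRing.comm x y ->
  exp_sum N x * exp_sum N y - exp_sum N (x + y) =
  \sum_(i < N) \sum_(j < N | (N <= i + j)%N)
     ((i`!%:R : F)^-1 * (j`!%:R)^-1) *: (x ^+ i * y ^+ j).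
Proof.
move=> cxy.
pose G i j : A := ((i`!%:R : F)^-1 * (j`!%:R)^-1) *: (x ^+ i * y ^+ j).
have -> : exp_sum N x * exp_sum N y = \sum_(i < N) \sum_(j < N) G i j.
  rewrite /exp_sum mulr_suml; apply: eq_bigr => i _.
  rewrite mulr_sumr; apply: eq_bigr => j _.
  by rewrite -scalerAl -scalerAr scalerA.
suff -> : exp_sum N (x + y) = \sum_(i < N) \sum_(j < N | (i + j < N)%N) G i j.
  apply/eqP; rewrite subr_eq -big_split/=; apply/eqP; apply: eq_bigr => i _.
  rewrite (bigID (fun j : 'I_N => N <= i + j)%N)/=; congr (_ + _).
  by apply: eq_bigl => j; rewrite -ltnNge.
transitivity (\sum_(m < N) \sum_(j < N | (j <= m)%N) G (m - j)%N j).
  apply: eq_bigr => m _.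
  rewrite (exprDn_comm _ cxy) scaler_sumr.
  pose H j := (m`!%:R : F)^-1 *: (x ^+ (m - j) * y ^+ j *+ 'C(m, j)).
  rewrite -(big_mkord predT H) (big_nat_widen _ _ N)//= big_mkord.
  apply: eq_bigr => j; rewrite ltnS => jm.
  rewrite /H /G -[X in _ *: X](scaler_nat 'C(m, j)) scalerA.
  congr (_ *: _); apply: (mulfI (_ : (m`!%:R : F) != 0)).
    by rewrite pnatr_eq0 -lt0n fact_gt0.
  rewrite mulrA mulfV ?mul1r; last by rewrite pnatr_eq0 -lt0n fact_gt0.
  by rewrite -(bin_fact jm) !natrM; field; rewrite !pnatr_eq0 -!lt0n !fact_gt0.
rewrite (exchange_big_dep predT)//= [RHS](exchange_big_dep predT)//=.
apply: eq_bigr => j _.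
rewrite -(big_mkord (fun m => j <= m)%N (fun m => G (m - j)%N j)).
rewrite -(big_mkord (fun i => i + j < N)%N (fun i => G i j)).
rewrite -(big_nat_widenl j 0 N predT)//.
rewrite -{1}(add0n (j : nat)) big_addn (big_nat_widen _ _ N) ?leq_subr//.
by apply: eq_big => [i|i _]; rewrite ?ltn_subRL ?addnK// addnC.
Qed.

Lemma exp_sum_series (R : realType) n (M : 'M[R[i]]_n.+1) N :
  series (fun k => (k`!%:R)^-1 *: M ^+ k) N = exp_sum N M.
Proof. by rewrite /series/= big_mkord. Qed.

Lemma exp_sum_real (R : realType) (x : R) N :
  exp_sum N (x : R^o) = series (exp_coeff x) N.
Proof.
by rewrite /series/= big_mkord; apply: eq_bigr => k _; rewrite /exp_coeff/= mulrC.
Qed.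

Lemma exp_sum_real_cvg (R : realType) (x : R) :
  ((fun N => exp_sum N (x : R^o)) @ \oo --> expR x)%classic.
Proof.
under eq_fun do rewrite exp_sum_real.
exact: is_cvg_series_exp_coeff.
Qed.

Lemma exp_sum_le_expR (R : realType) (x : R) N :
  0 <= x -> exp_sum N (x : R^o) <= expR x.
Proof.
move=> x0; rewrite exp_sum_real; apply: nondecreasing_cvgn_le.
  apply: nondecreasing_series => k _ _; exact: exp_coeff_ge0.
exact: is_cvg_series_exp_coeff.
Qed.

(** * Convergence of the matrix exponential *)

Lemma mx_norm_le_mxnorm1 (R : realType) m n (M : 'M[R[i]]_(m, n)) :
  mx_norm M <= (mxnorm1 M)%:C.
Proof.
have [->|/mx_norm_neq0[ij ->]] := eqVneq (mx_norm M) 0.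
  by rewrite ler0c mxnorm1_ge0.
have -> : `|M ij.1 ij.2| = (normc (M ij.1 ij.2))%:C by rewrite normc_def; case: (M _ _).
by rewrite lecR mxnorm1_entry.
Qed.

(** The way to compute [expmx], which is a limit in the topology of matrices, from
    estimates in the submultiplicative norm. *)
Lemma lim_mxnorm1 (R : realType) n
    (u : nat -> ('M[R[i]]_n.+1 : normedModType R[i])) (l : 'M[R[i]]_n.+1) :
  ((fun N => mxnorm1 (u N - l)) @ \oo --> (0 : R))%classic ->
  lim (u @ \oo)%classic = l.
Proof.
move=> ul; apply: cvg_lim; first exact: norm_hausdorff.
apply/cvgrPdist_lt => e e0.
have [eIm eRe] : complex.Im e = 0 /\ 0 < complex.Re e.
  by move: e0; rewrite ltcE/= => /andP[/eqP].
near=> N.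
have uN : mxnorm1 (u N - l) < complex.Re e.
  near: N; have /cvgrPdist_lt/(_ _ eRe) := ul.
  by apply: filterS => N; rewrite sub0r normrN ger0_norm// mxnorm1_ge0.
suff: mx_norm (l - u N) < e by [].
rewrite (le_lt_trans (mx_norm_le_mxnorm1 _))//.
rewrite -mxnorm1N opprB.
by rewrite ltcE/= eIm eqxx uN.
Unshelve. all: by end_near. Qed.

Lemma mxnorm1_le_ReIm (R : realType) m n (M : 'M[R[i]]_(m, n)) :
  mxnorm1 M <= \sum_i \sum_j (`|complex.Re (M i j)| + `|complex.Im (M i j)|).
Proof. by apply: ler_sum => i _; apply: ler_sum => j _; exact: normc_le_ReIm. Qed.

Lemma mxnorm1X_le (R : realType) n (M : 'M[R[i]]_n.+1) k :
  mxnorm1 (M ^+ k) <= n.+1%:R * mxnorm1 M ^+ k.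
Proof.
case: k => [|k]; last first.
  rewrite (le_trans (mxnorm1X _ _))// ler_peMl ?exprn_ge0 ?mxnorm1_ge0//.
  by rewrite ler1n.
rewrite !expr0 mulr1 /mxnorm1 -[X in _ <= X%:R]card_ord -sumr_const.
apply: ler_sum => i _; rewrite (bigD1 i)//= big1 => [|j ji].
  by rewrite mxE eqxx Normc.normc1 addr0.
by rewrite mxE eq_sym (negPf ji) Normc.normc0.
Qed.

Lemma fact_inv_normc (R : realType) k :
  normc ((k`!%:R : R[i])^-1) = (k`!%:R)^-1.
Proof. by rewrite Normc.normcV normc_nat. Qed.

Lemma is_cvg_dominated_series (R : realType) (u v : nat -> R) :
  (forall k, `|u k| <= v k) -> cvgn (series v) -> cvgn (series u).
Proof.
move=> uv cv; apply: normed_cvg; apply: series_le_cvg cv => // k.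
  exact: normr_ge0.
exact: le_trans (normr_ge0 _) (uv k).
Qed.

Lemma cvg_dist_limn (R : realType) (u : nat -> R) :
  cvgn u -> ((fun N => `|u N - limn u|) @ \oo --> (0 : R))%classic.
Proof.
move=> cu; rewrite -[X in (_ --> X)%classic](@normr0 _ R) -(subrr (limn u)).
by apply: cvg_norm; apply: cvgB => //; exact: cvg_cst.
Qed.

(** Each entry is split into real and imaginary parts, which are absolutely convergent
    real series dominated by the exponential series of [mxnorm1 M]. *)
Lemma exp_sum_cvg (R : realType) n (M : 'M[R[i]]_n.+1) :
  exists E, ((fun N => mxnorm1 (exp_sum N M - E)) @ \oo --> (0 : R))%classic.
Proof.
pose t k : 'M[R[i]]_n.+1 := (k`!%:R)^-1 *: M ^+ k.
(* the factor n + 1 is the norm of the identity, needed at k = 0 *)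
pose v k : R := n.+1%:R * exp_coeff (mxnorm1 M) k.
have tv i j k : normc (t k i j) <= v k.
  rewrite (le_trans (mxnorm1_entry _ _ _))// mxnorm1Z fact_inv_normc /v.
  by rewrite /exp_coeff/= mulrA mulrC ler_wpM2r ?invr_ge0// mxnorm1X_le.
have cv : cvgn (series v) by apply: is_cvg_seriesZ; exact: is_cvg_series_exp_coeff.
have cRe i j : cvgn (series (fun k => complex.Re (t k i j))).
  apply: is_cvg_dominated_series cv => k; exact: le_trans (ler_Re_normc _) (tv i j k).
have cIm i j : cvgn (series (fun k => complex.Im (t k i j))).
  apply: is_cvg_dominated_series cv => k; exact: le_trans (ler_Im_normc _) (tv i j k).
have sE N i j : exp_sum N M i j = series (fun k => complex.Re (t k i j)) N
                               +i* series (fun k => complex.Im (t k i j)) N.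
  rewrite -exp_sum_series /series/= summxE; elim/big_ind3: _ => //.
    by move=> x1 a1 b1 x2 a2 b2 -> ->; simpc.
  by move=> k _; rewrite /t; case: (_ i j).
pose E := \matrix_(i, j) (limn (series (fun k => complex.Re (t k i j)))
                         +i* limn (series (fun k => complex.Im (t k i j)))).
exists E.
apply: (squeeze_cvgr (f := cst 0)
  (h := fun N => \sum_i \sum_j (`|complex.Re ((exp_sum N M - E) i j)|
                                 + `|complex.Im ((exp_sum N M - E) i j)|))).
- near=> N; rewrite mxnorm1_ge0; exact: mxnorm1_le_ReIm.
- exact: cvg_cst.
- rewrite [X in (_ --> X)%classic](_ : 0 = \sum_(i < n.+1) \sum_(j < n.+1) (0 + 0)); last first.
    by rewrite big1// => i _; rewrite big1// => j _; rewrite addr0.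
  apply: cvg_big => [|i _]; first exact: add_continuous.
  apply: cvg_big => [|j _]; first exact: add_continuous.
  apply: cvgD.
    rewrite (_ : (fun N => _) = fun N =>
        `|series (fun k => complex.Re (t k i j)) N
          - limn (series (fun k => complex.Re (t k i j)))|).
      exact: cvg_dist_limn.
    by apply/funext => N; rewrite !mxE sE.
  rewrite (_ : (fun N => _) = fun N =>
      `|series (fun k => complex.Im (t k i j)) N
        - limn (series (fun k => complex.Im (t k i j)))|).
    exact: cvg_dist_limn.
  by apply/funext => N; rewrite !mxE sE.
Unshelve. all: by end_near. Qed.

Lemma expmx_cvg (R : realType) n (M : 'M[R[i]]_n.+1) :
  ((fun N => mxnorm1 (exp_sum N M - expmx M)) @ \oo --> (0 : R))%classic.
Proof.
have [E cE] := exp_sum_cvg M.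
suff -> : expmx M = E by [].
by apply: lim_mxnorm1; under eq_fun do rewrite exp_sum_series.
Qed.

(** * Functional equation, eigenvectors and Taylor remainder of the exponential *)

(** Identities between limits are proved below by exhibiting such a vanishing bound on
    their difference. *)
Lemma mxnorm1_le_cvg0 (R : realType) m n (X : 'M[R[i]]_(m, n)) (u : nat -> R) :
  (forall N, mxnorm1 X <= u N) -> (u @ \oo --> (0 : R))%classic -> X = 0.
Proof.
move=> Xu u0; apply: mxnorm1_eq0.
rewrite -(cvg_lim (@Rhausdorff R) u0); apply: limr_ge; first by apply/cvg_ex; exists 0.
by apply: nearW.
Qed.

Lemma mxnorm1_exp_sum_corner (R : realType) n (A B : 'M[R[i]]_n.+1) N :
  GRing.comm A B ->
  mxnorm1 (exp_sum N A * exp_sum N B - exp_sum N (A + B)) <=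
  n.+1%:R ^+ 2 * (exp_sum N (mxnorm1 A : R^o) * exp_sum N (mxnorm1 B : R^o)
                  - exp_sum N (mxnorm1 A + mxnorm1 B : R^o)).
Proof.
move=> cAB; rewrite exp_sum_mul// exp_sum_mul; last exact: mulrC.
rewrite mulr_sumr (le_trans (mxnorm1_sum _ _ _))//; apply: ler_sum => i _.
rewrite mulr_sumr (le_trans (mxnorm1_sum _ _ _))//; apply: ler_sum => j _.
rewrite mxnorm1Z Normc.normcM !fact_inv_normc [leRHS]mulrCA.
rewrite ler_wpM2l ?mulr_ge0 ?invr_ge0//.
rewrite (le_trans (mxnorm1M _ _))// expr2 mulrACA.
by rewrite ler_pM ?mxnorm1_ge0 ?mxnorm1X_le.
Qed.

(** The corner of [exp_sum_mul] is dominated by the real one, which tends to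
    [exp a * exp b - exp (a + b) = 0]. *)
Lemma expmxD (R : realType) n (A B : 'M[R[i]]_n.+1) :
  GRing.comm A B -> expmx (A + B) = expmx A * expmx B.
Proof.
move=> cAB; apply/eqP; rewrite eq_sym -subr_eq0; apply/eqP.
set a := mxnorm1 A; set b := mxnorm1 B.
pose d (M : 'M[R[i]]_n.+1) N := mxnorm1 (exp_sum N M - expmx M).
pose c N := n.+1%:R ^+ 2 * (exp_sum N (a : R^o) * exp_sum N (b : R^o)
                  - exp_sum N (a + b : R^o)).
apply: (@mxnorm1_le_cvg0 _ _ _ _ (fun N =>
  d A N * mxnorm1 (expmx B) + (mxnorm1 (expmx A) + d A N) * d B N
  + c N + d (A + B) N)) => [N|].
  set sA := exp_sum N A; set sB := exp_sum N B; set sC := exp_sum N (A + B).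
  have -> : expmx A * expmx B - expmx (A + B) =
    - ((sA - expmx A) *m expmx B) - sA *m (sB - expmx B)
    + (sA * sB - sC) + (sC - expmx (A + B)).
    by rewrite !mulmxE mulrBl mulrBr !opprB !addrA !subrK.
  apply: (le_trans (mxnorm1D _ _)); rewrite lerD//.
  apply: (le_trans (mxnorm1D _ _)); rewrite lerD ?mxnorm1_exp_sum_corner//.
  apply: (le_trans (mxnorm1D _ _)); rewrite !mxnorm1N lerD//; first exact: mxnorm1M.
  apply: (le_trans (mxnorm1M _ _)); rewrite ler_wpM2r ?mxnorm1_ge0//.
  rewrite -[sA](subrK (expmx A)) addrC.
  exact: mxnorm1D.
have cd M : (d M @ \oo --> (0 : R))%classic by exact: expmx_cvg.
have cc : (c @ \oo --> (0 : R))%classic.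
  rewrite -[X in (_ --> X)%classic](mulr0 (n.+1%:R ^+ 2)).
  apply: cvgMr; rewrite -[X in (_ --> X)%classic](subrr (expR a * expR b)) -{2}expRD.
  apply: cvgB; last exact: exp_sum_real_cvg.
  by apply: cvgM; exact: exp_sum_real_cvg.
rewrite [X in (_ --> X)%classic](_ : _ = 0 * mxnorm1 (expmx B)
  + (mxnorm1 (expmx A) + 0) * 0 + 0 + 0); last by rewrite mul0r mulr0 !addr0.
apply: cvgD => //; apply: cvgD => //; apply: cvgD.
  exact: cvgMl.
apply: cvgM => //; apply: cvgD => //; exact: cvg_cst.
Qed.

(** The complex exponential, as the matrix exponential in dimension one, so that it
    inherits convergence and eigenvector relations directly. *)
Definition cexp (R : realType) (z : R[i]) : R[i] := expmx (z%:M : 'M[R[i]]_1) 0 0.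

Definition cexp_sum (R : realType) N (z : R[i]) : R[i] :=
  \sum_(k < N) (k`!%:R)^-1 * z ^+ k.

Lemma exp_sum_scalar (R : realType) N (z : R[i]) :
  exp_sum N (z%:M : 'M[R[i]]_1) 0 0 = cexp_sum N z.
Proof.
rewrite /exp_sum summxE; apply: eq_bigr => k _.
by rewrite mxE -rmorphXn/= mxE eqxx mulr1n.
Qed.

Lemma cexp_cvg (R : realType) (z : R[i]) :
  ((fun N => normc (cexp_sum N z - cexp z)) @ \oo --> (0 : R))%classic.
Proof.
rewrite (_ : (fun N => _) = fun N =>
    mxnorm1 (exp_sum N (z%:M : 'M[R[i]]_1) - expmx z%:M)).
  exact: expmx_cvg.
apply/funext => N.
by rewrite /mxnorm1 !big_ord1 !mxE -exp_sum_scalar /exp_sum summxE.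
Qed.

Lemma exp_sum_eigenvec (R : realType) n p (M : 'M[R[i]]_n.+1)
    (W : 'M[R[i]]_(n.+1, p)) (z : R[i]) N :
  M *m W = z *: W -> exp_sum N M *m W = cexp_sum N z *: W.
Proof.
move=> MW; rewrite /exp_sum /cexp_sum mulmx_suml scaler_suml.
apply: eq_bigr => k _; rewrite -scalemxAl -scalerA; congr (_ *: _).
elim: (k : nat) => [|m IHm]; first by rewrite !expr0 mul1mx scale1r.
by rewrite exprSr -mulmxA MW -scalemxAr IHm scalerA exprS.
Qed.

Lemma expmx_eigenvec (R : realType) n p (M : 'M[R[i]]_n.+1)
    (W : 'M[R[i]]_(n.+1, p)) (z : R[i]) :
  M *m W = z *: W -> expmx M *m W = cexp z *: W.
Proof.
move=> MW; apply/eqP; rewrite -subr_eq0; apply/eqP.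
apply: (@mxnorm1_le_cvg0 _ _ _ _ (fun N =>
  mxnorm1 (exp_sum N M - expmx M) * mxnorm1 W
  + normc (cexp_sum N z - cexp z) * mxnorm1 W)) => [N|].
  have -> : expmx M *m W - cexp z *: W =
     - ((exp_sum N M - expmx M) *m W) + (cexp_sum N z - cexp z) *: W.
    by rewrite mulmxBl (exp_sum_eigenvec N MW) scalerBl opprB addrA subrK.
  rewrite (le_trans (mxnorm1D _ _))// mxnorm1N mxnorm1Z lerD//; exact: mxnorm1M.
rewrite [X in (_ --> X)%classic](_ : _ = 0 * mxnorm1 W + 0 * mxnorm1 W); last first.
  by rewrite mul0r addr0.
by apply: cvgD; apply: cvgMl; [exact: expmx_cvg|exact: cexp_cvg].
Qed.

Lemma expmx_comm (R : realType) n (M W : 'M[R[i]]_n.+1) :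
  GRing.comm M W -> GRing.comm (expmx M) W.
Proof.
move=> cMW; apply/eqP; rewrite -subr_eq0; apply/eqP.
apply: (@mxnorm1_le_cvg0 _ _ _ _ (fun N =>
  mxnorm1 (exp_sum N M - expmx M) * mxnorm1 W
  + mxnorm1 W * mxnorm1 (exp_sum N M - expmx M))) => [N|].
  have cS : exp_sum N M * W = W * exp_sum N M.
    apply: commr_sym; apply: commr_sum => k _.
    by rewrite /GRing.comm -scalerAr -scalerAl (commrX k (commr_sym cMW)).
  have -> : expmx M * W - W * expmx M =
     - ((exp_sum N M - expmx M) * W) + W * (exp_sum N M - expmx M).
    by rewrite mulrBl mulrBr cS opprB addrA subrK.
  by rewrite (le_trans (mxnorm1D _ _))// mxnorm1N lerD//; exact: mxnorm1M.
rewrite [X in (_ --> X)%classic](_ : _ = 0 * mxnorm1 W + mxnorm1 W * 0); last first.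
  by rewrite mul0r mulr0 addr0.
by apply: cvgD; [apply: cvgMl|apply: cvgMr]; exact: expmx_cvg.
Qed.

Lemma cexp_sum_tail (R : realType) p N (z : R[i]) :
  normc (cexp_sum (p + N) z - cexp_sum p z) <= normc z ^+ p * expR (normc z).
Proof.
rewrite /cexp_sum big_split_ord/= addrAC subrr add0r.
apply: le_trans (normc_sum _ _ _) _.
apply: (@le_trans _ _ (normc z ^+ p * exp_sum N (normc z : R^o))); last first.
  by rewrite ler_wpM2l ?exprn_ge0 ?normc_ge0// exp_sum_le_expR ?normc_ge0.
rewrite mulr_sumr; apply: ler_sum => k _.
rewrite Normc.normcM normcX fact_inv_normc exprD mulrCA.
rewrite ler_wpM2l ?exprn_ge0 ?normc_ge0//.
rewrite /GRing.scale/= ler_wpM2r ?exprn_ge0 ?normc_ge0//.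
by rewrite lef_pV2 ?posrE ?ltr0n ?fact_gt0// ler_nat leq_fact// leq_addl.
Qed.

(** At [p = 0] this also bounds the modulus of [cexp z] by [expR (normc z)]. *)
Lemma cexp_taylor (R : realType) p (z : R[i]) :
  normc (cexp z - cexp_sum p z) <= normc z ^+ p * expR (normc z).
Proof.
have c0 := cexp_cvg z.
have : ((fun N => normc (cexp_sum (N + p) z - cexp z) + normc z ^+ p * expR (normc z))
    @ \oo --> 0 + normc z ^+ p * expR (normc z))%classic.
  apply: cvgD; last exact: cvg_cst.
  by rewrite (cvg_shiftn p (fun N => normc (cexp_sum N z - cexp z))).
move=> c; rewrite -[leRHS]add0r -(cvg_lim (@Rhausdorff R) c).
apply: limr_ge; first by apply/cvg_ex; exists (0 + normc z ^+ p * expR (normc z)).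
apply: nearW => N.
rewrite -(subrKA (cexp_sum (N + p) z)) (le_trans (normcD _ _))// lerD//.
  by rewrite -normcN opprB.
by rewrite addnC cexp_sum_tail.
Qed.

Lemma expmx0 (R : realType) n : expmx (0 : 'M[R[i]]_n.+1) = 1.
Proof.
have e0 : cexp (0 : R[i]) = 1.
  apply/eqP; rewrite -subr_eq0; apply/eqP/Normc.eq0_normc/eqP.
  rewrite eq_le normc_ge0 andbT.
  have := cexp_taylor 1 (0 : R[i]).
  by rewrite /cexp_sum big_ord1 fact0 invr1 mulr1 Normc.normc0 expr1 mul0r.
have := @expmx_eigenvec R n n.+1 0 1%:M 0.
by rewrite e0 scale1r mul0mx scale0r mulmx1; apply.
Qed.

Lemma expmxMn (R : realType) n (M : 'M[R[i]]_n.+1) k :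
  expmx (M *+ k) = expmx M ^+ k.
Proof.
elim: k => [|k IHk]; first by rewrite mulr0n expmx0.
rewrite mulrS expmxD ?IHk ?exprS//.
by apply: commrMn; exact: commr_refl.
Qed.

(** * Spectral projectors *)

Lemma trmxX (F : comPzRingType) n (M : 'M[F]_n.+1) k : (M ^+ k)^T = M^T ^+ k.
Proof.
elim: k => [|k IHk]; first by rewrite !expr0 trmx1.
by rewrite exprS exprSr -!mulmxE trmx_mul IHk.
Qed.

(** A commuting right inverse [Y] of [M - a] on the complement certifies that the
    eigenvalue is semisimple with projector [P]: raising [(M - a) Y = 1 - P] to the
    power [n + 1] shows that the range of [(M - a) ^ (n + 1)] contains that of [1 - P], and
    [P] annihilates this range. *)
Lemma spectral_projE (F : fieldType) n (M P Y : 'M[F]_n.+1) (a : F) :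
  (M - a%:M) * P = 0 -> (M - a%:M) * Y = 1 - P -> GRing.comm M Y ->
  spectral_proj M a = P.
Proof.
set K := M - a%:M => KP0 KY cMY.
have cKY : GRing.comm K Y.
  by apply/commr_sym/commrB; [exact: commr_sym|exact: comm_mx_scalar].
have cKP : GRing.comm K P.
  rewrite -[P](subKr 1) -KY; apply: commrB; first exact: commr1.
  by apply: commrM => //; exact: commr_refl.
have idem k : (1 - P) ^+ k.+1 = 1 - P.
  elim: k => [|k IHk]; first by rewrite expr1.
  rewrite exprS IHk mulrBr mulr1 -{2}KY.
  by rewrite cKY -mulrA KP0 mulr0 subr0.
have KYn : K ^+ n.+1 * Y ^+ n.+1 = 1 - P by rewrite -exprMn_comm// KY idem.
have YKn : Y ^+ n.+1 * K ^+ n.+1 = 1 - P.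
  by rewrite -KYn; apply/commrX/commr_sym/commrX/commr_sym/commr_sym.
have KnP : K ^+ n.+1 * P = 0 by rewrite exprSr -mulrA KP0 mulr0.
have PKn : P * K ^+ n.+1 = 0 by rewrite exprS mulrA -cKP KP0 mul0r.
have trK : (M^T - a%:M) ^+ n.+1 = (K ^+ n.+1)^T.
  by rewrite trmxX /K linearB/= tr_scalar_mx.
apply: trmx_inj; rewrite /spectral_proj trmxK geigenspaceE trK.
set N := (K ^+ n.+1)^T.
have PN : P^T *m N = 0 by rewrite -trmx_mul mulmxE KnP trmx0.
have NP : N *m P^T = 0 by rewrite -trmx_mul mulmxE PKn trmx0.
have Qe : 1%:M - P^T = (Y ^+ n.+1)^T *m N.
  by rewrite -trmx_mul mulmxE KYn linearB/= trmx1.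
have eQ : 1%:M - P^T = N *m (Y ^+ n.+1)^T.
  by rewrite -trmx_mul mulmxE YKn linearB/= trmx1.
have cap0 : (kermx N :&: N = 0)%MS.
  set W := (_ :&: _)%MS.
  have /sub_kermxP WN : (W <= kermx N)%MS by exact: capmxSl.
  have /submxP[X WX] : (W <= N)%MS by exact: capmxSr.
  rewrite -[W]mulmx1 -(subrK P^T 1%:M) mulmxDr {1}eQ mulmxA WN mul0mx add0r.
  by rewrite WX -mulmxA NP mulmx0.
set pr := proj_mx _ _.
rewrite -[pr]mul1mx -(subrK P^T 1%:M) mulmxDl Qe proj_mx_0 ?submxMl//.
by rewrite add0r proj_mx_id//; apply/sub_kermxP.
Qed.

(** * The two implicit stages on an eigenvector *)

Lemma real_complex_divn (R : realType) (x : R) (k : nat) :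
  (x / k%:R)%:C = x%:C / k%:R.
Proof. by rewrite rmorphM fmorphV rmorph_nat. Qed.

(** Since [A w = lam w - B w], numerator and denominator act on the plane of [w] and
    [B w] alone.  The scalar is the quotient that cancels the [w] components; the
    [B w] components then match up to the cubic term. *)
Lemma Pstar_eigenvec (R : realType) n (h : R) (A B : 'M[R[i]]_n) (w : 'cV_n)
    (lam : R[i]) (z := h%:C * lam) :
  (A + B) *m w = lam *: w -> Pstar_den h A B \in unitmx ->
  Pstar h A B *m w = (1 + z / 2 + z ^+ 2 / 8) *: w
    - (h%:C * z ^+ 3 / 64) *: (invmx (Pstar_den h A B) *m (B *m w)).
Proof.
move=> Lw uD; rewrite /Pstar -mulmxA.
set D := Pstar_den h A B; set y := B *m w.
have Aw : A *m w = lam *: w - y by rewrite -Lw mulmxDl addrK.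
have -> : (1%:M + (h / 2)%:C *: A + (h ^+ 2 / 8)%:C *: (A *m (A + B))) *m w =
  (1 + z / 2 + z ^+ 2 / 8) *: (D *m w) - (h%:C * z ^+ 3 / 64) *: y.
  rewrite /D /Pstar_den !real_complex_divn !rmorphXn/=.
  rewrite !mulmxDl !mulNmx !mul1mx -!scalemxAl -!mulmxA Lw -!scalemxAr -/y Aw.
  by apply/matrixP => i j; rewrite !mxE /z; field.
by rewrite mulmxBr -!scalemxAr mulKmx.
Qed.

(** Same cancellation as in [Pstar_eigenvec]: the full step reproduces the exponential
    to order four, with one error term of its own and one inherited from the stage. *)
Lemma S_step_eigenvec (R : realType) n (h : R) (A B : 'M[R[i]]_n) (w : 'cV_n)
    (lam : R[i]) (z := h%:C * lam) :
  (A + B) *m w = lam *: w ->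
  Pstar_den h A B \in unitmx -> S_den h A B \in unitmx ->
  S_step h A B *m w =
    (1 + z + z ^+ 2 / 2 + z ^+ 3 / 6 + z ^+ 4 / 24) *: w
    + (h%:C * (z ^+ 4 / 72 - z ^+ 5 / 144)) *: (invmx (S_den h A B) *m (B *m w))
    - (h%:C ^+ 3 * z ^+ 3 / 192) *:
      (invmx (S_den h A B) *m
         ((A - B) *m (A + B) *m (invmx (Pstar_den h A B) *m (B *m w)))).
Proof.
move=> Lw uDp uD; rewrite /S_step.
set N := (X in invmx _ *m X); rewrite -[_ *m N *m w]mulmxA.
set D := S_den h A B; set y := B *m w; set g := invmx (Pstar_den h A B) *m y.
have Aw : A *m w = lam *: w - y by rewrite -Lw mulmxDl addrK.
have -> : N *m w = (1 + z + z ^+ 2 / 2 + z ^+ 3 / 6 + z ^+ 4 / 24) *: (D *m w)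
    + (h%:C * (z ^+ 4 / 72 - z ^+ 5 / 144)) *: y
    - (h%:C ^+ 3 * z ^+ 3 / 192) *: ((A - B) *m (A + B) *m g).
  rewrite /N /D /S_den !real_complex_divn !rmorphXn/=.
  have AB v : (A - B) *m v = A *m v - B *m v by rewrite mulmxBl.
  have Ww : (A - B) *m (A + B) *m w = lam *: (lam *: w - y - y).
    by rewrite -mulmxA Lw -scalemxAr AB Aw.
  set W := (A - B) *m (A + B) in Ww *.
  rewrite !mulmxDl -!scalemxAl.
  rewrite -(mulmxA W) (Pstar_eigenvec Lw uDp).
  rewrite -/y -/g -/z mulmxBr -!scalemxAr Ww; set Q := W *m g.
  rewrite !mulNmx !mul1mx -scalemxAl -!mulmxA Lw -!scalemxAr Aw -/y.
  by apply/matrixP => i j; rewrite !mxE /z; field.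
by rewrite mulmxBr mulmxDr -!scalemxAr mulKmx.
Qed.

(** * Rank-one structure of the relaxation system *)

Section Relaxation.
Variables (R : realType) (ax ay cx cy eps : R) (dx dy : R[i]).

Let A := matA ax ay dx dy.
Let B := matB cx cy eps.
Let s := sym_s cx cy dx dy.
Let r := sym_r ax ay dx dy.
Let e := eps%:C.

Definition row_u : 'rV[R[i]]_3 := \row_j nth 0 [:: 1; 0; 0] j.
(** The symbol of the divergence of the flux [(v, q)].  With [row_u] it spans a space of
    rows that is stable under right multiplication by [matA] and [matB]
    ([row_u_A], [row_div_A], [row_u_B], [row_div_B]); the dynamics of [u] closes on
    these two components. *)
Definition row_div : 'rV[R[i]]_3 := \row_j nth 0 [:: 0; dx; dy] j.

Ltac entries3 := rewrite ?(mxE, big_ord_recl, big_ord0)/=.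

Lemma row_u_A : row_u *m A = - row_div.
Proof.
apply/rowP => j; entries3; case: j => [[|[|[|//]]] ?] /=; entries3; ring.
Qed.

Lemma row_div_A : row_div *m A = - r *: row_u.
Proof.
apply/rowP => j; entries3; rewrite /r /sym_r.
case: j => [[|[|[|//]]] ?] /=; entries3; ring.
Qed.

Lemma row_u_B : row_u *m B = 0.
Proof.
apply/rowP => j; entries3; case: j => [[|[|[|//]]] ?] /=; entries3; ring.
Qed.

Lemma row_div_B : row_div *m B = e^-1 *: (s *: row_u - row_div).
Proof.
apply/rowP => j; entries3; rewrite /s /sym_s /e fmorphV/=.
case: j => [[|[|[|//]]] ?] /=; entries3; ring.
Qed.

(** Common form of the matrices inverted in the two stages. *)
Definition den (al be : R[i]) : 'M[R[i]]_3 := 1%:M - al *: B + be *: (B *m (A + B)).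

Lemma row_u_den al be : row_u *m den al be = row_u.
Proof.
rewrite /den mulmxDr mulmxBr mulmx1 -(scalemxAr al) -(scalemxAr be) mulmxA row_u_B !mul0mx !scaler0.
by rewrite subr0 addr0.
Qed.

(** On the span of [row_u] and [row_div] the matrix [den] is triangular; the diagonal
    entry found here is the only factor of its determinant that involves [s]. *)
Lemma row_div_den al be :
  row_div *m den al be = (1 + al / e + be / e ^+ 2 - be * s / e) *: row_div
    + (- (al / e + be / e ^+ 2) * s + be * r / e) *: row_u.
Proof.
rewrite /den mulmxDr mulmxBr mulmx1 -(scalemxAr al) -(scalemxAr be) mulmxA row_div_B -scalemxAl.
rewrite mulmxDr mulmxBl mulmxBl -!scalemxAl row_u_A row_div_A row_u_B row_div_B.
by apply/matrixP => i j; rewrite !mxE -exprVn; ring.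
Qed.

Definition col3 (x y z : R[i]) : 'cV[R[i]]_3 := \col_i nth 0 [:: x; y; z] i.

Lemma matA_outer : A = - (col3 1 0 0 *m row_div)
  - col3 0 ((ax ^+ 2)%:C * dx) ((ay ^+ 2)%:C * dy) *m row_u.
Proof.
apply/matrixP => i j; entries3.
by case: i j => [[|[|[|//]]] ?] [[|[|[|//]]] ?] /=; ring.
Qed.

Lemma matB_outer : B = e^-1 *: (col3 1 cx%:C cy%:C *m row_u - 1%:M).
Proof.
apply/matrixP => i j; entries3; rewrite /e fmorphV.
by case: i j => [[|[|[|//]]] ?] [[|[|[|//]]] ?] /=; ring.
Qed.

Lemma matA_ker (g : 'cV[R[i]]_3) : row_u *m g = 0 -> row_div *m g = 0 -> A *m g = 0.
Proof.
by move=> ug dg; rewrite matA_outer mulmxBl mulNmx -!mulmxA ug dg !mulmx0 subr0 oppr0.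
Qed.

Lemma matB_ker (g : 'cV[R[i]]_3) : row_u *m g = 0 -> B *m g = - e^-1 *: g.
Proof.
move=> ug; rewrite matB_outer -scalemxAl mulmxBl -mulmxA ug mulmx0 mul1mx sub0r.
by rewrite scalerN scaleNr.
Qed.

(** A vector of the kernel has vanishing [row_u] and [row_div] components by the
    triangular form; on such vectors [A] is zero and [B] is [- 1 / eps], so [den] is
    scalar. *)
Lemma den_unit al be :
  1 + al / e + be / e ^+ 2 != 0 -> 1 + al / e + be / e ^+ 2 - be * s / e != 0 ->
  den al be \in unitmx.
Proof.
move=> p0 om0.
rewrite -unitmx_tr -row_free_unit; apply: inj_row_free => v vD.
have Dg : den al be *m v^T = 0 by rewrite -[den _ _]trmxK -trmx_mul vD trmx0.
apply: trmx_inj; rewrite trmx0; set g := v^T in Dg *.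
have ug : row_u *m g = 0 by rewrite -(row_u_den al be) -mulmxA Dg mulmx0.
have dg : row_div *m g = 0.
  have := row_div_den al be; move=> /(congr1 (fun M => M *m g)).
  rewrite -mulmxA Dg mulmx0 mulmxDl -!scalemxAl ug scaler0 addr0 => /esym/eqP.
  by rewrite scaler_eq0 (negPf om0) => /eqP.
have Ag : A *m g = 0 by apply: matA_ker.
have Bg : B *m g = - e^-1 *: g by apply: matB_ker.
have : den al be *m g = (1 + al / e + be / e ^+ 2) *: g.
  rewrite /den mulmxDl mulmxBl mul1mx -(scalemxAl al) -(scalemxAl be) -mulmxA.
  rewrite mulmxDl Ag Bg add0r -scalemxAr Bg.
  by apply/matrixP => i j; rewrite !mxE -exprVn; ring.
by rewrite Dg => /esym/eqP; rewrite scaler_eq0 (negPf p0) => /eqP.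
Qed.
End Relaxation.

(** * The slow mode *)

Section SlowMode.
Variables (R : realType) (ax ay cx cy eps : R) (dx dy lam : R[i]).

Let A := matA ax ay dx dy.
Let B := matB cx cy eps.
Let L := matL ax ay cx cy eps dx dy.
Let s := sym_s cx cy dx dy.
Let r := sym_r ax ay dx dy.
Let e := eps%:C.
Let eta := 1 + e * lam.
Let nu := eta * (2 * eta - 1).
Let u := row_u R.
Let d := row_div dx dy.

Definition col_c : 'cV[R[i]]_3 := col3 0 cx%:C cy%:C.
Definition col_a : 'cV[R[i]]_3 := col3 0 ((ax ^+ 2)%:C * dx) ((ay ^+ 2)%:C * dy).
(** The eigenvectors are scaled by [eta] so that no division remains: their entries are
    polynomial in [eps] and [eta], hence bounded as [eps] tends to [0]. *)
Definition slow_col : 'cV[R[i]]_3 := eta *: col3 1 0 0 + (col_c - e *: col_a).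
Definition slow_row : 'rV[R[i]]_3 := eta *: u - e *: d.
Let w := slow_col.
Let l := slow_row.

Ltac entry1 := apply/matrixP => i j; rewrite !ord1 !(mxE, big_ord_recl, big_ord0)/=.

Ltac scal1 := apply/matrixP => i j; rewrite !ord1 ?mxE ?eqxx ?mulr1n.

Lemma row_u_first : u *m col3 1 0 0 = 1%:M. Proof. by entry1; ring. Qed.
Lemma row_u_col_c : u *m col_c = 0. Proof. by entry1; ring. Qed.
Lemma row_u_col_a : u *m col_a = 0. Proof. by entry1; ring. Qed.
Lemma row_div_first : d *m col3 1 0 0 = 0. Proof. by entry1; ring. Qed.
Lemma row_div_col_c : d *m col_c = s%:M.
Proof. by entry1; rewrite /s /sym_s mulr1n; ring. Qed.
Lemma row_div_col_a : d *m col_a = r%:M.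
Proof. by entry1; rewrite /r /sym_r mulr1n; ring. Qed.

Hypothesis e0 : e != 0.
Hypothesis rel : lam * eta = e * r - s.

Lemma row_u_slow : u *m w = eta%:M.
Proof.
rewrite /w /slow_col mulmxDr mulmxBr -!scalemxAr row_u_first row_u_col_c row_u_col_a.
by rewrite scaler0 subr0 addr0 scalemx1.
Qed.

Lemma row_div_slow : d *m w = (- (lam * eta))%:M.
Proof.
rewrite /w /slow_col mulmxDr mulmxBr -!scalemxAr row_div_first row_div_col_c row_div_col_a.
by rewrite scaler0 add0r rel; scal1; ring.
Qed.

Lemma slow_row_col : l *m w = nu%:M.
Proof.
rewrite /l /slow_row mulmxBl -!scalemxAl row_u_slow row_div_slow.
by scal1; rewrite /nu /eta; ring.
Qed.

Let q : 'rV[R[i]]_3 := u - e *: d.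
Let g : 'cV[R[i]]_3 := col_c - e *: col_a.
Let M : 'M[R[i]]_3 := col3 1 0 0 *m q + g *m u.

(** [eps L + 1] is a sum of two outer products, so that its square is computed from four
    scalar products. *)
Lemma matL_outer : L = e^-1 *: (M - 1%:M).
Proof.
have eA : A = - (col3 1 0 0 *m d) - col_a *m u by exact: matA_outer.
have eB : B = e^-1 *: ((col3 1 0 0 + col_c) *m u - 1%:M).
  rewrite [LHS]matB_outer; congr (_ *: (_ *m _ - _)).
  by apply/colP => -[[|[|[|//]]] ?]; rewrite !mxE /=; ring.
have -> : L = A + B by [].
rewrite eA eB /M /q /g mulmxBr mulmxDl mulmxBl -scalemxAr -scalemxAl.
move: (col3 1 0 0 *m u) (col3 1 0 0 *m d) (col_c *m u) (col_a *m u) => ? ? ? ?.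
by apply/matrixP => i j; rewrite !mxE; field.
Qed.

(** Cayley-Hamilton in factored form: the quotient of the characteristic polynomial by
    [X - lam], evaluated at [L], is the rank-one matrix [w l] up to a scalar. *)
Lemma relaxed_quadratic : M *m M = w *m l - (e * lam) *: M.
Proof.
have qc0 : q *m col3 1 0 0 = 1%:M.
  by rewrite /q mulmxBl -scalemxAl row_u_first row_div_first scaler0 subr0.
have qg : q *m g = (e * lam * eta)%:M.
  rewrite /q /g mulmxBl !mulmxBr -!(scalemxAl e) -!scalemxAr.
  rewrite row_u_col_c row_u_col_a row_div_col_c row_div_col_a.
  by scal1; rewrite -mulrA rel; ring.
have ug : u *m g = 0.
  by rewrite /g mulmxBr -scalemxAr row_u_col_c row_u_col_a scaler0 subr0.
have lq : l = q + (e * lam) *: u.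
  by apply/rowP => j; rewrite !mxE /eta; ring.
have wE : w = eta *: col3 1 0 0 + g by [].
have ME : M = col3 1 0 0 *m q + g *m u by [].
clearbody M g q w l.
have MM : M *m M = col3 1 0 0 *m q + (e * lam * eta) *: (col3 1 0 0 *m u) + g *m q.
  rewrite ME mulmxDl -!mulmxA !mulmxDr !(mulmxA q) !(mulmxA u) qc0 qg row_u_first ug.
  by rewrite !mul1mx mul0mx mulmx0 addr0 mul_scalar_mx -scalemxAr.
rewrite MM lq wE ME mulmxDl !mulmxDr -!(scalemxAl eta) -!scalemxAr.
move: (col3 1 0 0 *m u) (col3 1 0 0 *m q) (g *m q) (g *m u) => ? ? ? ?.
by apply/matrixP => i j; rewrite !mxE /eta; ring.
Qed.

Lemma slow_eigenvec : L *m w = lam *: w.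
Proof.
have qw : q *m w = (eta + e * lam * eta)%:M.
  by rewrite /q mulmxBl -scalemxAl row_u_slow row_div_slow; scal1; ring.
rewrite matL_outer -(scalemxAl e^-1) mulmxBl mul1mx /M mulmxDl -!mulmxA qw row_u_slow.
rewrite !mul_mx_scalar.
have comb (c g' : 'cV[R[i]]_3) : e^-1 *: ((eta + e * lam * eta) *: c + eta *: g'
    - (eta *: c + g')) = lam *: (eta *: c + g').
  by apply/matrixP => i j; rewrite !mxE /eta; field.
exact: comb.
Qed.

Hypothesis nu0 : nu != 0.

(** The witness [Y] is, up to a scalar, the divided difference at [lam] of the quadratic
    polynomial whose value at [L] is [w l]. *)
Lemma Proj_s_outer : spectral_proj L lam = nu^-1 *: (w *m l).
Proof.
(* eps L + 1 = M, so that M - eta is eps (L - lam) *)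
pose Y : 'M[R[i]]_3 := - (e / nu) *: (M + (2 * eta - 1)%:M).
have Llam : L - lam%:M = e^-1 *: (M - eta%:M).
  rewrite matL_outer; move: M => M'.
  apply/matrixP => i j; rewrite !mxE; case: (i == j); rewrite ?mulr1n ?mulr0n /eta; field => //.
apply: (@spectral_projE _ _ _ _ Y).
- rewrite -mulmxE -scalemxAr mulmxA.
  rewrite (_ : (L - lam%:M) *m w = 0) ?mul0mx ?scaler0//.
  by rewrite mulmxBl slow_eigenvec mul_scalar_mx subrr.
- have [n1 n2] : eta != 0 /\ 2 * eta - 1 != 0.
    by apply/andP; rewrite -negb_or -mulf_eq0.
  have eE : e * lam = eta - 1 by rewrite /eta addrC addKr.
  have comb (M' W : 'M[R[i]]_3) : M' *m M' = W - (e * lam) *: M' ->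
      e^-1 *: (M' - eta%:M) *m (- (e / nu) *: (M' + (2 * eta - 1)%:M))
      = 1%:M - nu^-1 *: W.
    clearbody eta => M2; rewrite -scalemxAl -scalemxAr mulmxBl !mulmxDr M2.
    rewrite mul_mx_scalar !mul_scalar_mx.
    apply/matrixP => i j; rewrite !mxE.
    by case: (i == j); rewrite ?mulr1n ?mulr0n; rewrite /nu; field: eE; rewrite e0 n1 n2.
  by rewrite Llam -mulmxE; exact: comb relaxed_quadratic.
- rewrite matL_outer /Y /GRing.comm -!scalerAl -!scalerAr !scalerA mulrC.
  congr (_ *: _); apply: commrD; last exact: comm_mx_scalar.
  by apply/commr_sym/commrB; [exact: commr_refl|exact: commr1].
Qed.

(** [w l] is a polynomial in [L] by [relaxed_quadratic]. *)
Lemma slow_outer_comm : GRing.comm L (w *m l).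
Proof.
have -> : w *m l = M * M + (e * lam) *: M by rewrite -mulmxE relaxed_quadratic subrK.
rewrite matL_outer; apply: commr_sym; rewrite /GRing.comm -scalerAl -scalerAr.
congr (_ *: _); apply: commrB; last exact: commr1.
apply: commr_sym; apply: commrD; first by apply: commrM; exact: commr_refl.
by rewrite /GRing.comm -scalerAl -scalerAr.
Qed.

Let D al be := den ax ay cx cy eps dx dy al be.
Let om al be := 1 + al / e + be / e ^+ 2 - be * s / e.
Let kap al be := - (al / e + be / e ^+ 2) * s + be * r / e.

Lemma row_u_den_inv al be : D al be \in unitmx -> u *m invmx (D al be) = u.
Proof.
move=> Du; have uD : u *m D al be = u by exact: row_u_den.
by rewrite -{1}uD mulmxK.
Qed.

Lemma row_div_den_inv al be : D al be \in unitmx -> om al be != 0 ->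
  d *m invmx (D al be) = (om al be)^-1 *: (d - kap al be *: u).
Proof.
move=> Du om0; have dD : d *m D al be = om al be *: d + kap al be *: u.
  exact: row_div_den.
have uD : u *m D al be = u by exact: row_u_den.
apply: (can_inj (mulmxK Du)); rewrite mulmxKV// -scalemxAl mulmxBl -scalemxAl.
by rewrite uD dD addrK scalerA mulVf// scale1r.
Qed.

Let bet := s * lam + r.

Lemma row_u_B_slow : u *m (B *m w) = 0.
Proof. by rewrite mulmxA [u *m B]row_u_B mul0mx. Qed.

(** The slow vector is close to equilibrium: although [B] is of order [1/eps], this
    component of [B w] is bounded uniformly in [eps]. *)
Lemma row_div_B_slow : d *m (B *m w) = bet%:M.
Proof.
rewrite mulmxA [d *m B]row_div_B -scalemxAl mulmxBl -scalemxAl row_u_slow row_div_slow.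
by scal1; rewrite rel /bet /eta -/s -/e; field.
Qed.

(** The first component loses one power of [1/eps] only, the second one two; the latter
    is compensated by the weight, of order [eps], of [row_div] in [slow_row]. *)
Lemma stage_defect_rows (v : 'cV[R[i]]_3) (psi : R[i]) :
  u *m v = 0 -> d *m v = psi%:M ->
  u *m ((A - B) *m L *m v) = (psi / e)%:M /\
  d *m ((A - B) *m L *m v) = ((r + s / e - e ^- 2) * psi)%:M.
Proof.
move=> uv dv; have LE : L = A + B by [].
have uA : u *m A = - d by exact: row_u_A.
have uB : u *m B = 0 by exact: row_u_B.
have dA : d *m A = - r *: u by exact: row_div_A.
have dB : d *m B = e^-1 *: (s *: u - d) by exact: row_div_B.
have uLv : u *m (L *m v) = (- psi)%:M.
  by rewrite mulmxA LE mulmxDr uA uB addr0 mulNmx dv; scal1.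
have dLv : d *m (L *m v) = (- (psi / e))%:M.
  rewrite mulmxA LE mulmxDr dA dB mulmxDl -!scalemxAl mulmxBl -scalemxAl uv dv.
  by scal1; ring.
rewrite -mulmxA !(mulmxA _ (A - B)) !mulmxBr uA uB dA dB; split.
  by rewrite subr0 mulNmx dLv; scal1; ring.
rewrite mulmxBl -!scalemxAl mulmxBl -scalemxAl uLv dLv.
by scal1; rewrite -exprVn; ring.
Qed.

(** [mu] and [m1] are the coordinates of [slow_row] times the inverse of [S_den] in
    [(row_div, row_u)], and [psi] is the [row_div] component of the stage error. *)
Lemma slow_step (h : R) :
  let hc := h%:C in let z := hc * lam in
  let om1 := om hc (hc ^+ 2 / 6) in let om2 := om (hc / 2) (hc ^+ 2 / 8) in
  let mu := - e / om1 in let psi := bet / om2 in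
  let m1 := eta - mu * kap hc (hc ^+ 2 / 6) in
  Pstar_den h A B \in unitmx -> S_den h A B \in unitmx -> om1 != 0 -> om2 != 0 ->
  l *m (S_step h A B *m w) =
  ((1 + z + z ^+ 2 / 2 + z ^+ 3 / 6 + z ^+ 4 / 24) * nu
   + hc * (z ^+ 4 / 72 - z ^+ 5 / 144) * (mu * bet)
   - hc ^+ 3 * z ^+ 3 / 192 * (m1 * psi / e + mu * ((r + s / e - e ^- 2) * psi)))%:M.
Proof.
move=> hc z om1 om2 mu psi m1 uDp uD om1_0 om2_0.
rewrite (S_step_eigenvec slow_eigenvec uDp uD) -/hc -/z.
have SD : S_den h A B = D hc (hc ^+ 2 / 6).
  by rewrite /S_den /D /den real_complex_divn rmorphXn.
have PD : Pstar_den h A B = D (hc / 2) (hc ^+ 2 / 8).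
  by rewrite /Pstar_den /D /den !real_complex_divn rmorphXn.
rewrite SD PD in uD uDp *.
set v := invmx (D (hc / 2) _) *m _.
have uv : u *m v = 0 by rewrite mulmxA row_u_den_inv// row_u_B_slow.
have dv : d *m v = psi%:M.
  rewrite mulmxA row_div_den_inv// -(scalemxAl (_^-1)) mulmxBl -(scalemxAl (kap _ _)).
  rewrite row_u_B_slow row_div_B_slow.
  by scal1; rewrite /psi -/om2; ring.
have [uW dW] := stage_defect_rows uv dv.
have lD : l *m invmx (D hc (hc ^+ 2 / 6)) = m1 *: u + mu *: d.
  rewrite /l /slow_row mulmxBl -!scalemxAl row_u_den_inv// row_div_den_inv// -/om1.
  by apply/rowP => j; rewrite !mxE /m1 /mu; ring.
have lDX (X : 'cV[R[i]]_3) : l *m (invmx (D hc (hc ^+ 2 / 6)) *m X) =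
    m1 *: (u *m X) + mu *: (d *m X).
  by rewrite mulmxA lD mulmxDl -(scalemxAl m1) -(scalemxAl mu).
rewrite mulmxBr mulmxDr -!scalemxAr slow_row_col !lDX row_u_B_slow row_div_B_slow uW dW.
by scal1; ring.
Qed.
End SlowMode.

(** * Elementary estimates *)

Lemma normcM_le (R : realType) (x y : R[i]) (a b : R) :
  normc x <= a -> normc y <= b -> normc (x * y) <= a * b.
Proof. by move=> xa yb; rewrite Normc.normcM ler_pM ?normc_ge0. Qed.

Lemma normcD_le (R : realType) (x y : R[i]) (a b : R) :
  normc x <= a -> normc y <= b -> normc (x + y) <= a + b.
Proof. by move=> xa yb; rewrite (le_trans (normcD _ _))// lerD. Qed.

Lemma normcB_le (R : realType) (x y : R[i]) (a b : R) :
  normc x <= a -> normc y <= b -> normc (x - y) <= a + b.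
Proof. by move=> xa yb; rewrite (le_trans (normcB _ _))// lerD. Qed.

Lemma normc_real_le (R : realType) (x a : R) : 0 <= x <= a -> normc x%:C <= a.
Proof. by move=> /andP[x0 xa]; rewrite normc_real ger0_norm. Qed.

Lemma normc_eq0 (R : realType) (z : R[i]) : (normc z == 0) = (z == 0).
Proof.
by apply/eqP/eqP => [/Normc.eq0_normc//|->]; exact: Normc.normc0.
Qed.

Lemma normc_gt0 (R : realType) (z : R[i]) : (0 < normc z) = (z != 0).
Proof. by rewrite lt_def normc_ge0 andbT normc_eq0. Qed.

Lemma Re_sqrtc_ge0 (R : realType) (z : R[i]) : 0 <= complex.Re (sqrtc z).
Proof. by case: z => a b; exact: sqrtr_ge0. Qed.

(** Applied with [s] the imaginary symbol of the convection: the stage denominators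
    are bounded below without any restriction on [h]. *)
Lemma ler_normc_sub_imaginary (R : realType) (q t : R) (s : R[i]) :
  complex.Re s = 0 -> q <= normc (q%:C - t%:C * s).
Proof.
case: s => a b /= ->; simpc.
by rewrite (le_trans (ler_norm q))// -sqrtr_sqr ler_wsqrtr// lerDl sqr_ge0.
Qed.

(** Telescoping: stability enters only through a common bound [m] of the two factors. *)
Lemma normc_expB (R : realType) (x y : R[i]) (m : R) n :
  1 <= m -> normc x <= m -> normc y <= m ->
  normc (x ^+ n - y ^+ n) <= n%:R * normc (x - y) * m ^+ n.
Proof.
move=> m1 xm ym; have m0 : 0 <= m by exact: le_trans m1.
rewrite subrXX Normc.normcM -mulrA (mulrCA n%:R) ler_wpM2l ?normc_ge0//.
apply: le_trans (normc_sum _ _ _) _.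
rewrite mulr_natl -[X in _ *+ X](card_ord n) -sumr_const.
apply: ler_sum => i _; rewrite Normc.normcM !normcX.
apply: (@le_trans _ _ (m ^+ (n.-1 - i) * m ^+ i)).
  by rewrite ler_pM ?exprn_ge0 ?normc_ge0// lerXn2r ?nnegrE ?normc_ge0.
rewrite -exprD ler_weXn2l//.
by rewrite -ltnS; case: n i => [[]//|n] i; rewrite /= subnK ?ltnS// -ltnS.
Qed.

(** * Uniform bound on the local defect *)

Section SlowEigenvalue.
Variables (R : realType) (ax ay cx cy eps : R) (dx dy : R[i]).
Let s := sym_s cx cy dx dy.
Let r := sym_r ax ay dx dy.
Let e := eps%:C.
Let zeta := zeta2 ax ay cx cy eps dx dy.
Let lam := lambda_s ax ay cx cy eps dx dy.

Lemma zeta2_sqr : zeta ^+ 2 = 1 - 4 * e * s + 4 * e ^+ 2 * r.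
Proof. by rewrite /zeta /zeta2 sqr_sqrtc rmorphXn. Qed.

(** This is where the choice of the root with nonnegative real part is used. *)
Lemma normc_one_plus_zeta2_ge1 : 1 <= normc (1 + zeta).
Proof.
rewrite (le_trans _ (ler_Re_normc _))// (le_trans _ (ler_norm _))//.
have := Re_sqrtc_ge0 (1 - 4 * eps%:C * s + 4 * (eps ^+ 2)%:C * r).
by rewrite /zeta /zeta2; case: (sqrtc _) => a b /=; rewrite lerDl.
Qed.

Lemma one_plus_zeta2_neq0 : 1 + zeta != 0.
Proof. by rewrite -normc_gt0 (lt_le_trans ltr01)// normc_one_plus_zeta2_ge1. Qed.

Lemma slow_eta : 1 + e * lam = (1 + zeta) / 2.
Proof.
rewrite /lam /lambda_s -/e -/s -/r -/zeta.
have z1 := one_plus_zeta2_neq0; have z2 := zeta2_sqr.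
by field: z2.
Qed.

(** The normalisation [eta * (2 * eta - 1)] of the slow projector thus has [zeta2] as
    its second factor, so the lower bound on [zeta2] keeps the projector bounded. *)
Lemma zeta2_eta : 2 * (1 + e * lam) - 1 = zeta.
Proof. by rewrite slow_eta; field. Qed.

Lemma lambda_s_rel : lam * (1 + e * lam) = e * r - s.
Proof.
rewrite slow_eta /lam /lambda_s -/e -/s -/r -/zeta.
by have z1 := one_plus_zeta2_neq0; field.
Qed.

Lemma normc_eta_ge : 2^-1 <= normc (1 + e * lam).
Proof.
rewrite slow_eta Normc.normcM Normc.normcV (normc_nat R 2).
by rewrite ler_peMl ?invr_ge0// normc_one_plus_zeta2_ge1.
Qed.

Lemma normc_lambda_s_le (eps0 : R) : 0 <= eps <= eps0 ->
  normc lam <= 2 * (eps0 * normc r + normc s).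
Proof.
move=> eps_itv; have eta0 : 1 + e * lam != 0.
  by rewrite -normc_gt0 (lt_le_trans _ normc_eta_ge)// invr_gt0.
have -> : lam = (1 + e * lam)^-1 * (e * r - s).
  by rewrite -lambda_s_rel [RHS]mulrC mulfK.
rewrite -[2 in leRHS]invrK; apply: normcM_le.
  by rewrite Normc.normcV lef_pV2 ?posrE ?invr_gt0 ?normc_gt0// normc_eta_ge.
apply: normcB_le => //; apply: normcM_le => //; exact: normc_real_le.
Qed.
End SlowEigenvalue.

(** [S] and [T] stand for the moduli of [sym_s] and [sym_r], and [Lam] bounds the slow
    eigenvalue. *)
Definition defect_const (R : realType) (eps0 S T Lam : R) : R :=
  (Lam ^+ 4 / 72 + Lam ^+ 5 / 144) * (eps0 * (S * Lam + T))
  + Lam ^+ 3 / 192 * (2 * (S * Lam + T))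
    * (1 + eps0 * Lam + (eps0 * S + T) + 1 * (eps0 ^+ 2 * T + eps0 * S + 1)).

Section Defect.
Variables (R : realType) (ax ay cx cy eps h eps0 : R) (dx dy lam : R[i]) (Lam : R).
Let A := matA ax ay dx dy.
Let B := matB cx cy eps.
Let s := sym_s cx cy dx dy.
Let r := sym_r ax ay dx dy.
Let e := eps%:C.
Let eta := 1 + e * lam.
Let S := normc s.
Let T := normc r.

Let de := h / eps.
Let hc := h%:C.
Let z := hc * lam.
Let om1 := 1 + hc / e + hc ^+ 2 / 6 / e ^+ 2 - hc ^+ 2 / 6 * s / e.
Let om2 := 1 + hc / 2 / e + hc ^+ 2 / 8 / e ^+ 2 - hc ^+ 2 / 8 * s / e.
Let kap := - (hc / e + hc ^+ 2 / 6 / e ^+ 2) * s + hc ^+ 2 / 6 * r / e.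
Let mu := - e / om1.
Let bet := s * lam + r.
Let psi := bet / om2.
Let m1 := eta - mu * kap.

Hypothesis eps_itv : 0 < eps <= eps0.
Hypothesis h_itv : 0 < h <= 1.
Hypothesis s_im : complex.Re s = 0.
Hypothesis lam_le : normc lam <= Lam.

Let eps_gt0 : 0 < eps. Proof. by case/andP: eps_itv. Qed.
Let h_gt0 : 0 < h. Proof. by case/andP: h_itv. Qed.
Let h_le1 : h <= 1. Proof. by case/andP: h_itv. Qed.
Let de_gt0 : 0 < de. Proof. exact: divr_gt0. Qed.
Let e0 : e != 0.
Proof. by rewrite -normc_gt0 normc_real normr_gt0 gt_eqF. Qed.

Lemma S_den_factor_ge : 1 + de + de ^+ 2 / 6 <= normc om1.
Proof.
(* the real part does not depend on s, which is imaginary *)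
rewrite (_ : om1 = (1 + de + de ^+ 2 / 6)%:C - (h * de / 6)%:C * s).
  exact: ler_normc_sub_imaginary.
rewrite /om1 /de !(rmorphD, rmorphM, rmorphXn, fmorphV, rmorph1, rmorph_nat)/=.
by rewrite -/e -/hc; field.
Qed.

Lemma Pstar_den_factor_ge : 1 + de / 2 + de ^+ 2 / 8 <= normc om2.
Proof.
rewrite (_ : om2 = (1 + de / 2 + de ^+ 2 / 8)%:C - (h * de / 8)%:C * s).
  exact: ler_normc_sub_imaginary.
rewrite /om2 /de !(rmorphD, rmorphM, rmorphXn, fmorphV, rmorph1, rmorph_nat)/=.
by rewrite -/e -/hc; field.
Qed.

Lemma S_den_factor_ge1 : 1 <= normc om1.
Proof.
apply: le_trans S_den_factor_ge; rewrite -addrA lerDl.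
by have := sqr_ge0 de; have := de_gt0; lra.
Qed.

Lemma Pstar_den_factor_ge1 : 1 <= normc om2.
Proof.
apply: le_trans Pstar_den_factor_ge; rewrite -addrA lerDl.
by have := sqr_ge0 de; have := de_gt0; lra.
Qed.

Lemma S_den_factor_neq0 : om1 != 0.
Proof. by rewrite -normc_gt0 (lt_le_trans ltr01)// S_den_factor_ge1. Qed.

Lemma Pstar_den_factor_neq0 : om2 != 0.
Proof. by rewrite -normc_gt0 (lt_le_trans ltr01)// Pstar_den_factor_ge1. Qed.

Lemma S_den_unit : S_den h A B \in unitmx.
Proof.
have -> : S_den h A B = den ax ay cx cy eps dx dy hc (hc ^+ 2 / 6).
  by rewrite /S_den /den real_complex_divn rmorphXn.
apply: den_unit; last exact: S_den_factor_neq0.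
rewrite (_ : _ + _ = (1 + de + de ^+ 2 / 6)%:C).
  rewrite -normc_gt0 normc_real normr_gt0 gt_eqF//.
  by have := sqr_ge0 de; have := de_gt0; lra.
rewrite /de !(rmorphD, rmorphM, rmorphXn, fmorphV, rmorph1, rmorph_nat)/=.
by rewrite -/e -/hc; field.
Qed.

Lemma Pstar_den_unit : Pstar_den h A B \in unitmx.
Proof.
have -> : Pstar_den h A B = den ax ay cx cy eps dx dy (hc / 2) (hc ^+ 2 / 8).
  by rewrite /Pstar_den /den !real_complex_divn rmorphXn.
apply: den_unit; last exact: Pstar_den_factor_neq0.
rewrite (_ : _ + _ = (1 + de / 2 + de ^+ 2 / 8)%:C).
  rewrite -normc_gt0 normc_real normr_gt0 gt_eqF//.
  by have := sqr_ge0 de; have := de_gt0; lra.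
rewrite /de !(rmorphD, rmorphM, rmorphXn, fmorphV, rmorph1, rmorph_nat)/=.
by rewrite -/e -/hc; field.
Qed.

Lemma normc_div_le (x y : R[i]) (c : R) :
  y != 0 -> normc x <= c * normc y -> normc (x / y) <= c.
Proof.
by move=> y0 xy; rewrite Normc.normcM Normc.normcV ler_pdivrMr ?normc_gt0.
Qed.

Let Bt := S * Lam + T.
Let M1 := 1 + eps0 * Lam + (eps0 * S + T).

Let e_le : normc e <= eps0.
Proof. by apply: normc_real_le; case/andP: eps_itv => /ltW-> ->. Qed.
Let hc_le : normc hc <= h.
Proof. by apply: normc_real_le; rewrite lexx ltW. Qed.
Let hc_le1 : normc hc <= 1.
Proof. exact: le_trans hc_le h_le1. Qed.
Let z_le : normc z <= h * Lam.
Proof. exact: normcM_le. Qed.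
Let eps0_ge0 : 0 <= eps0.
Proof. by case/andP: eps_itv => /ltW; exact: le_trans. Qed.

Lemma row_div_reaction_le : normc bet <= Bt.
Proof. by apply: normcD_le => //; exact: normcM_le. Qed.

Lemma dual_div_le : normc mu <= eps0.
Proof.
apply: normc_div_le S_den_factor_neq0 _; rewrite normcN (le_trans e_le)// ler_peMr//.
exact: S_den_factor_ge1.
Qed.

(** The fast components of [slow_row] are of order [eps]; dividing them by [eps] costs
    nothing. *)
Lemma dual_div_over_eps_le : normc (mu / e) <= 1.
Proof.
rewrite (_ : mu / e = - om1^-1); last by rewrite /mu; field; rewrite e0 S_den_factor_neq0.
by rewrite normcN Normc.normcV invf_le1 ?S_den_factor_ge1// normc_gt0 S_den_factor_neq0.
Qed.

Lemma dual_shift_le : normc (mu * kap) <= eps0 * S + T.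
Proof.
have -> : mu * kap = e * ((de + de ^+ 2 / 6)%:C / om1) * s - hc ^+ 2 / 6 / om1 * r.
  rewrite /mu /kap /de !(rmorphD, rmorphM, rmorphXn, fmorphV, rmorph1, rmorph_nat)/=.
  by rewrite -/e -/hc; field; rewrite e0 S_den_factor_neq0.
apply: normcB_le.
  rewrite -[eps0]mulr1; apply: normcM_le => //; apply: normcM_le => //.
  apply: normc_div_le S_den_factor_neq0 _; rewrite mul1r.
  apply: le_trans S_den_factor_ge; apply: normc_real_le; have := sqr_ge0 de; have := de_gt0; lra.
rewrite -[T]mul1r; apply: normcM_le => //; apply: normc_div_le S_den_factor_neq0 _.
rewrite mul1r; apply: le_trans S_den_factor_ge1; apply: normc_div_le.
  by rewrite pnatr_eq0.
rewrite (normc_nat R 6) mul1r normcX.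
apply: (@le_trans _ _ 1); last by rewrite ler1n.
by rewrite exprn_ile1// normc_ge0.
Qed.

Lemma dual_u_le : normc m1 <= M1.
Proof.
apply: normcB_le dual_shift_le; apply: normcD_le; first by rewrite Normc.normc1.
exact: normcM_le.
Qed.

(** The factor [h / eps] is absorbed by the stage denominator, which is at least
    [h / (2 eps)].  This is the power of [h] that the norm of the stage error misses. *)
Lemma stage_div_le : normc (hc / e * psi) <= 2 * Bt.
Proof.
have -> : hc / e * psi = (de%:C / om2) * bet.
  rewrite /psi /de rmorphM fmorphV /= -/e -/hc.
  by field; rewrite e0 Pstar_den_factor_neq0.
apply: normcM_le row_div_reaction_le; apply: normc_div_le Pstar_den_factor_neq0 _.
have := Pstar_den_factor_ge; rewrite normc_real (ger0_norm (ltW de_gt0)).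
have := sqr_ge0 de; have := de_gt0; lra.
Qed.

(** Regrouping [h^3 / eps * psi] as [h^2 (h / eps * psi)] and [mu] as [eps (mu / eps)] leaves
    only factors that are bounded uniformly in [eps]. *)
Lemma slow_defect_le :
  normc (hc * (z ^+ 4 / 72 - z ^+ 5 / 144) * (mu * bet)
   - hc ^+ 3 * z ^+ 3 / 192 * (m1 * psi / e + mu * ((r + s / e - e ^- 2) * psi)))
  <= defect_const eps0 S T Lam * h ^+ 5.
Proof.
have Lam0 : 0 <= Lam by exact: le_trans (normc_ge0 _) lam_le.
have Bt0 : 0 <= Bt by rewrite addr_ge0 ?mulr_ge0 ?normc_ge0.
have M10 : 0 <= M1 by rewrite !addr_ge0 ?mulr_ge0 ?normc_ge0.
have natV k : normc (k%:R^-1 : R[i]) <= k%:R^-1 by rewrite Normc.normcV normc_nat.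
rewrite (_ : _ - _ = hc * (z ^+ 4 / 72 - z ^+ 5 / 144) * (mu * bet)
  - hc ^+ 2 * (z ^+ 3 / 192) * (hc / e * psi)
    * (m1 + mu / e * (e ^+ 2 * r + e * s - 1))); last by rewrite -!exprVn; field.
have zX k : normc (z ^+ k) <= (h * Lam) ^+ k.
  by rewrite normcX lerXn2r ?nnegrE ?normc_ge0// mulr_ge0// ltW.
have bnd : normc (hc * (z ^+ 4 / 72 - z ^+ 5 / 144) * (mu * bet)
  - hc ^+ 2 * (z ^+ 3 / 192) * (hc / e * psi)
    * (m1 + mu / e * (e ^+ 2 * r + e * s - 1))) <=
  h * ((h * Lam) ^+ 4 / 72 + (h * Lam) ^+ 5 / 144) * (eps0 * Bt)
  + h ^+ 2 * ((h * Lam) ^+ 3 / 192) * (2 * Bt)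
     * (M1 + 1 * (eps0 ^+ 2 * T + eps0 * S + 1)).
  apply: normcB_le; apply: normcM_le.
  - apply: normcM_le => //; apply: normcB_le; apply: normcM_le => //; exact: natV.
  - exact: normcM_le dual_div_le row_div_reaction_le.
  - apply: normcM_le stage_div_le; apply: normcM_le.
      by rewrite normcX lerXn2r ?nnegrE ?normc_ge0// ltW.
    by apply: normcM_le => //; exact: natV.
  - apply: normcD_le dual_u_le _; apply: normcM_le dual_div_over_eps_le _.
    apply: normcB_le; last by rewrite Normc.normc1.
    apply: normcD_le; apply: normcM_le => //.
    by rewrite normcX lerXn2r ?nnegrE ?normc_ge0.
apply: le_trans bnd _.
rewrite /defect_const -/Bt -/M1 [leRHS]mulrDl lerD//; last first.
  by rewrite le_eqVlt; apply/orP; left; apply/eqP; ring.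
rewrite (_ : h * _ * _ = (Lam ^+ 4 / 72 + h * (Lam ^+ 5 / 144)) * (eps0 * Bt)
  * h ^+ 5); last by ring.
apply: ler_wpM2r; first by rewrite exprn_ge0// ltW.
apply: ler_wpM2r; first by rewrite mulr_ge0.
by rewrite lerD2l ler_piMl// mulr_ge0// exprn_ge0.
Qed.
End Defect.

(** * From one step to the global error *)

(** The two summands act on complementary spaces. *)
Lemma projected_power (F : comNzRingType) (A : algType F) (P E : A) (a : F) n :
  P * P = P -> E * P = P * E ->
  (a *: P + E * (1 - P)) ^+ n = a ^+ n *: P + E ^+ n * (1 - P).
Proof.
move=> PP EP; have PQ : P * (1 - P) = 0 by rewrite mulrBr mulr1 PP subrr.
have QP : (1 - P) * P = 0 by rewrite mulrBl mul1r PP subrr.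
have QQ : (1 - P) * (1 - P) = 1 - P by rewrite mulrBl mul1r PQ subr0.
have EQ k : (1 - P) * E ^+ k = E ^+ k * (1 - P).
  by apply: commrX; apply: commr_sym; apply: commrB => //; exact: commr1.
have EPn k : P * E ^+ k = E ^+ k * P by apply: commrX; apply: commr_sym.
move: (1 - P) PQ QP QQ EQ (subrK P 1) => Q PQ QP QQ EQ Q1.
elim: n => [|n IHn]; first by rewrite !expr0 scale1r mul1r addrC.
rewrite exprS IHn mulrDl !mulrDr -!scalerAl -!scalerAr PP scalerA -exprS.
rewrite [P * _]mulrA EPn -mulrA PQ mulr0 scaler0 addr0 -(mulrA E Q P) QP mulr0.
by rewrite scaler0 add0r -(mulrA E) (mulrA Q) EQ -mulrA QQ mulrA -exprS.
Qed.

(** Lady Windermere's fan for scalars: [n] local errors of size [h^5], each transported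
    with amplification at most [expR (T * (Lam + C))]. *)
Lemma power_error (R : realType) (x c : R[i]) (h Lam C T : R) (n : nat) :
  0 < h <= 1 -> 0 <= Lam -> 0 <= C ->
  normc c <= expR (h * Lam) -> normc (x - c) <= C * h ^+ 5 -> n%:R * h <= T ->
  normc (x ^+ n - c ^+ n) <= T * C * expR (T * (Lam + C)) * h ^+ 4.
Proof.
move=> /andP[h_gt0 h_le1] Lam0 C0 c_le xc nhT; have h_ge0 := ltW h_gt0.
pose m := expR (h * (Lam + C)).
have LC0 : 0 <= Lam + C by exact: addr_ge0.
have m1 : 1 <= m by rewrite -[leLHS]expR0 ler_expR mulr_ge0.
have cm : normc c <= m by rewrite (le_trans c_le)// ler_expR ler_pM2l// lerDl.
have xm : normc x <= m.
  rewrite -(subrK c x) (le_trans (normcD _ _))// /m mulrDr expRD.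
  have h5 : h ^+ 5 <= h by rewrite -[leRHS]expr1 ler_wiXn2l.
  have e1 : 1 <= expR (h * Lam) by rewrite -[leLHS]expR0 ler_expR mulr_ge0.
  (* the local error is absorbed in the growth rate: h^5 <= h and 1 + h C <= expR (h C) *)
  apply: (@le_trans _ _ (expR (h * Lam) * (1 + h * C))); last first.
    by rewrite ler_wpM2l ?expR_ge0// expR_ge1Dx.
  rewrite mulrDr mulr1 addrC lerD// (le_trans xc)//.
  apply: (@le_trans _ _ (h * C)); first by rewrite mulrC ler_wpM2r.
  by rewrite ler_peMl// mulr_ge0.
apply: le_trans (normc_expB n m1 xm cm) _.
have mK : m ^+ n <= expR (T * (Lam + C)).
  by rewrite /m -expRM_natl ler_expR mulrA ler_wpM2r.
apply: (@le_trans _ _ (n%:R * (C * h ^+ 5) * expR (T * (Lam + C)))).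
  rewrite ler_pM ?mulr_ge0 ?normc_ge0 ?exprn_ge0 ?(le_trans _ m1)//.
  by rewrite ler_wpM2l.
set K := expR (T * _).
rewrite (_ : _ * K = (n%:R * h) * (C * K * h ^+ 4)); last by ring.
rewrite (_ : T * _ * _ * _ = T * (C * K * h ^+ 4)); last by ring.
by rewrite ler_wpM2r// !mulr_ge0 ?expR_ge0 ?exprn_ge0.
Qed.

Section OneMode.
Variables (R : realType) (ax ay cx cy eps0 gam Lam h eps : R) (dx dy : R[i]).
Let s := sym_s cx cy dx dy.
Let r := sym_r ax ay dx dy.
Let A := matA ax ay dx dy.
Let B := matB cx cy eps.
Let L := matL ax ay cx cy eps dx dy.
Let lam := lambda_s ax ay cx cy eps dx dy.
Let e := eps%:C.
Let eta := 1 + e * lam.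
Let nu := eta * (2 * eta - 1).
Let w := slow_col ax ay cx cy eps dx dy lam.
Let l := slow_row eps dx dy lam.
Let P := nu^-1 *: (w *m l).
Let z := h%:C * lam.

Hypothesis eps_itv : 0 < eps <= eps0.
Hypothesis h_itv : 0 < h <= 1.
Hypothesis gam_gt0 : 0 < gam.
Hypothesis s_im : complex.Re s = 0.
Hypothesis lam_le : normc lam <= Lam.
Hypothesis zeta_ge : gam <= normc (zeta2 ax ay cx cy eps dx dy).

Let e0 : e != 0.
Proof.
by rewrite -normc_gt0 normc_real normr_gt0 gt_eqF//; case/andP: eps_itv.
Qed.

Let rel : lam * eta = e * r - s. Proof. exact: lambda_s_rel. Qed.

Let nu_ge : gam / 2 <= normc nu.
Proof.
rewrite /nu zeta2_eta Normc.normcM mulrC ler_pM ?invr_ge0//; first exact: ltW.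
exact: normc_eta_ge.
Qed.

Let nu_gt0 : 0 < normc nu.
Proof. by apply: lt_le_trans nu_ge; exact: divr_gt0. Qed.

Let nu0 : nu != 0. Proof. by rewrite -normc_gt0. Qed.

Let nuV : normc nu^-1 <= 2 / gam.
Proof. by rewrite Normc.normcV -[2 / gam]invf_div lef_pV2 ?posrE ?divr_gt0. Qed.

Let Lam0 : 0 <= Lam. Proof. exact: le_trans (normc_ge0 _) lam_le. Qed.

Let e_le : normc e <= eps0.
Proof. by apply: normc_real_le; case/andP: eps_itv => /ltW -> ->. Qed.

Let z_le : normc z <= h * Lam.
Proof.
apply: normcM_le lam_le; apply: normc_real_le; rewrite lexx andbT.
by case/andP: h_itv => /ltW.
Qed.

Let lw : l *m w = nu%:M. Proof. exact: slow_row_col. Qed.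
Let Lw : L *m w = lam *: w. Proof. exact: slow_eigenvec. Qed.

(** The scalar by which the base step acts on the slow line after projection. *)
Definition slow_multiplier : R[i] := (l *m (S_step h A B *m w)) 0 0 / nu.

Lemma slow_proj_idem : P * P = P.
Proof.
rewrite /P -mulmxE -scalemxAl -scalemxAr -mulmxA (mulmxA l) lw mul_scalar_mx.
by rewrite -scalemxAr !scalerA mulVf// mulr1.
Qed.

Lemma slow_proj_compress : P *m S_step h A B *m P = slow_multiplier *: P.
Proof.
rewrite /slow_multiplier /P.
move: (S_step h A B) w l nu => S w' l' nu'.
rewrite -!scalemxAl -scalemxAr.
have -> : w' *m l' *m S *m (w' *m l') = w' *m (l' *m (S *m w')) *m l'.
  by rewrite !mulmxA.
rewrite [l' *m (S *m w')]mx11_scalar mul_mx_scalar -scalemxAl !scalerA.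
by congr (_ *: _); rewrite -mx11_scalar mulrC mulrA.
Qed.

Lemma expmx_slow_proj : expmx (h%:C *: L) * P = cexp z *: P.
Proof.
rewrite /P -mulmxE -scalemxAr mulmxA (@expmx_eigenvec _ _ _ _ _ z).
  by rewrite -scalemxAl !scalerA mulrC.
by rewrite -scalemxAl Lw scalerA.
Qed.

Lemma expmx_slow_proj_comm : expmx (h%:C *: L) * P = P * expmx (h%:C *: L).
Proof.
apply: expmx_comm; rewrite /GRing.comm /P -!scalerAl -!scalerAr !scalerA.
by rewrite mulrC; congr (_ *: _); exact: slow_outer_comm.
Qed.

Lemma R_SFRC_split : R_SFRC ax ay cx cy h eps dx dy =
  slow_multiplier *: P + expmx (h%:C *: L) * (1 - P).
Proof.
have PE : Proj_s ax ay cx cy eps dx dy = P by exact: Proj_s_outer.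
by rewrite /R_SFRC /Proj_f PE -slow_proj_compress.
Qed.

(** The fast components cancel exactly. *)
Lemma R_SFRC_power_error n :
  R_SFRC ax ay cx cy h eps dx dy ^+ n - expmx ((n%:R * h)%:C *: L) =
  (slow_multiplier ^+ n - cexp z ^+ n) *: P.
Proof.
have -> : expmx ((n%:R * h)%:C *: L) = expmx (h%:C *: L) ^+ n.
  by rewrite -expmxMn rmorphM rmorph_nat -scalerA scaler_nat.
rewrite R_SFRC_split projected_power ?slow_proj_idem ?expmx_slow_proj_comm//.
have := expmx_slow_proj; move: (expmx _) P => E Q EQ.
have EnQ : E ^+ n * Q = cexp z ^+ n *: Q.
  elim: n => [|n IHn]; first by rewrite !expr0 mul1r scale1r.
  by rewrite exprSr -mulrA EQ -scalerAr IHn scalerA exprS.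
by rewrite mulrBr mulr1 EnQ scalerBl addrA addrAC addrK.
Qed.

Definition multiplier_const (C1 : R) : R := 2 / gam * C1 + Lam ^+ 5 * expR Lam.

Lemma slow_multiplier_error : normc (slow_multiplier - cexp z) <=
  multiplier_const (defect_const eps0 (normc s) (normc r) Lam) * h ^+ 5.
Proof.
have [h_gt0 h_le1] := andP h_itv; have h_ge0 := ltW h_gt0.
pose E4 := 1 + z + z ^+ 2 / 2 + z ^+ 3 / 6 + z ^+ 4 / 24.
have E4E : E4 = cexp_sum 5 z.
  by rewrite /cexp_sum !big_ord_recl big_ord0/= /E4 /bump /= !factS fact0; field.
rewrite -(subrKA E4) mulrDl; apply: normcD_le.
  rewrite /slow_multiplier (slow_step e0 rel (Pstar_den_unit _ _ eps_itv h_itv s_im)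
    (S_den_unit _ _ eps_itv h_itv s_im) (S_den_factor_neq0 eps_itv h_itv s_im)
    (Pstar_den_factor_neq0 eps_itv h_itv s_im)) mxE eqxx mulr1n -addrA mulrDl mulfK//.
  rewrite addrAC subrr add0r mulrC -[leRHS]mulrA; apply: normcM_le nuV _.
  exact: (slow_defect_le ax ay eps_itv h_itv s_im lam_le).
rewrite -normcN opprB E4E (le_trans (cexp_taylor 5 z))//.
rewrite [leRHS]mulrAC -exprMn ler_pM ?exprn_ge0 ?expR_ge0 ?normc_ge0//.
  by rewrite lerXn2r ?nnegrE ?normc_ge0 ?mulr_ge0// mulrC.
by rewrite ler_expR (le_trans z_le)// ler_piMl.
Qed.

Lemma normc_cexp_slow_le : normc (cexp z) <= expR (h * Lam).
Proof.
have := cexp_taylor 0 z; rewrite /cexp_sum big_ord0 subr0 expr0 mul1r.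
by move=> /le_trans -> //; rewrite ler_expR.
Qed.

Definition proj_const : R := 2 / gam *
  (((1 + eps0 * Lam) * mxnorm1 (col3 1 0 0 : 'cV[R[i]]_3)
    + (mxnorm1 (col_c cx cy) + eps0 * mxnorm1 (col_a ax ay dx dy)))
   * ((1 + eps0 * Lam) * mxnorm1 (row_u R) + eps0 * mxnorm1 (row_div dx dy))).

Lemma slow_proj_le : mxnorm1 P <= proj_const.
Proof.
have eta_le : normc eta <= 1 + eps0 * Lam.
  by apply: normcD_le; [rewrite Normc.normc1|exact: normcM_le].
rewrite /P mxnorm1Z /proj_const; apply: ler_pM => //; rewrite ?normc_ge0 ?mxnorm1_ge0//.
apply: le_trans (mxnorm1M _ _) _; apply: ler_pM; rewrite ?mxnorm1_ge0//.
  apply: le_trans (mxnorm1D _ _) _; apply: lerD.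
    by rewrite mxnorm1Z ler_wpM2r ?mxnorm1_ge0.
  apply: le_trans (mxnorm1D _ _) _; rewrite mxnorm1N; apply: lerD => //.
  by rewrite mxnorm1Z ler_wpM2r ?mxnorm1_ge0.
apply: le_trans (mxnorm1D _ _) _; rewrite mxnorm1N; apply: lerD.
  by rewrite mxnorm1Z ler_wpM2r ?mxnorm1_ge0.
by rewrite mxnorm1Z ler_wpM2r ?mxnorm1_ge0.
Qed.
End OneMode.

Lemma defect_const_ge0 (R : realType) (eps0 S T Lam : R) :
  0 <= eps0 -> 0 <= S -> 0 <= T -> 0 <= Lam -> 0 <= defect_const eps0 S T Lam.
Proof.
move=> *; rewrite /defect_const.
by rewrite !(addr_ge0, mulr_ge0, exprn_ge0, invr_ge0, ler0n).
Qed.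

(** Every bound entering [C] holds for all [eps] at once, and is fixed before [eps] and
    [h] are introduced; this is the uniformity in the stiffness. *)
Lemma mode_error (R : realType) (ax ay cx cy eps0 gam T kx ky : R) :
  0 < eps0 -> 0 < gam -> 0 < T ->
  (forall eps, 0 <= eps <= eps0 ->
     gam <= normc (zeta2 ax ay cx cy eps (dsym kx) (dsym ky))) ->
  exists2 C : R, 0 <= C &
    forall eps h, 0 < eps <= eps0 -> 0 < h <= 1 ->
      (Pstar_den h (matA ax ay (dsym kx) (dsym ky)) (matB cx cy eps) \in unitmx /\
       S_den h (matA ax ay (dsym kx) (dsym ky)) (matB cx cy eps) \in unitmx) /\
      forall (v : 'cV[R[i]]_3) (n : nat), n%:R * h <= T ->
        enorm (R_SFRC ax ay cx cy h eps (dsym kx) (dsym ky) ^+ n *m v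
          - expmx ((n%:R * h)%:C *: matL ax ay cx cy eps (dsym kx) (dsym ky)) *m v)
        <= C * h ^+ 4 * enorm v.
Proof.
move=> eps0_gt0 gam_gt0 T_gt0 zeta_ge; have eps0_ge0 := ltW eps0_gt0.
have s_im : complex.Re (sym_s cx cy (dsym kx) (dsym ky)) = 0.
  by rewrite /sym_s /dsym; simpc => /=; ring.
move: (dsym kx) (dsym ky) zeta_ge s_im => dx dy zeta_ge s_im.
have [Lam lam_le] : exists Lam, forall eps, 0 < eps <= eps0 ->
    normc (lambda_s ax ay cx cy eps dx dy) <= Lam.
  exists (2 * (eps0 * normc (sym_r ax ay dx dy) + normc (sym_s cx cy dx dy))).
  by move=> eps /andP[/ltW eps_ge0 eps_le]; apply: normc_lambda_s_le; apply/andP.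
have Lam0 : 0 <= Lam.
  by apply: le_trans (normc_ge0 _) (lam_le eps0 _); rewrite eps0_gt0 lexx.
have [C2 C20 HC2] : exists2 C2, 0 <= C2 & multiplier_const gam Lam
    (defect_const eps0 (normc (sym_s cx cy dx dy)) (normc (sym_r ax ay dx dy)) Lam) = C2.
  eexists; last reflexivity.
  rewrite addr_ge0// mulr_ge0 ?exprn_ge0 ?expR_ge0 ?defect_const_ge0 ?normc_ge0//.
  by rewrite divr_ge0// ltW.
have zeta_ge' eps : 0 < eps <= eps0 -> gam <= normc (zeta2 ax ay cx cy eps dx dy).
  by move=> /andP[/ltW eps_ge0 eps_le]; apply: zeta_ge; apply/andP.
pose Cp := proj_const ax ay cx cy eps0 gam Lam dx dy.
have proj_le eps (eps_itv : 0 < eps <= eps0) :=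
  slow_proj_le eps_itv gam_gt0 (lam_le eps eps_itv) (zeta_ge' eps eps_itv).
have Cp0 : 0 <= Cp.
  by apply: le_trans (mxnorm1_ge0 _) (proj_le eps0 _); rewrite eps0_gt0 lexx.
have K0 := mulr_ge0 (mulr_ge0 (ltW T_gt0) C20) (expR_ge0 (T * (Lam + C2))).
exists (T * C2 * expR (T * (Lam + C2)) * Cp); first exact: mulr_ge0 K0 Cp0.
move=> eps h eps_itv h_itv; split.
  split; first exact: Pstar_den_unit _ _ eps_itv h_itv s_im.
  exact: S_den_unit _ _ eps_itv h_itv s_im.
move=> v n nhT; rewrite -mulmxBl (R_SFRC_power_error h eps_itv gam_gt0
  (zeta_ge' eps eps_itv)).
apply: le_trans (enorm_mul _ _) _; apply: ler_wpM2r; first exact: sqrtr_ge0.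
rewrite mxnorm1Z mulrAC; apply: ler_pM (proj_le eps eps_itv).
- exact: normc_ge0.
- exact: mxnorm1_ge0.
apply: power_error nhT => //.
  exact: normc_cexp_slow_le h_itv (lam_le eps eps_itv).
rewrite -HC2; exact: (slow_multiplier_error eps_itv h_itv gam_gt0 s_im
  (lam_le eps eps_itv) (zeta_ge' eps eps_itv)).
Qed.

Theorem theorem6p3 (R : realType) (ax ay cx cy eps0 : R) (K : {fset R * R})
    (heps0 : 0 < eps0)
    (hzeta : exists2 gamma2 : R, 0 < gamma2 &
       forall (eps : R) (k : R * R), 0 <= eps <= eps0 -> k \in K ->
         gamma2 <= Normc.normc (zeta2 ax ay cx cy eps (dsym k.1) (dsym k.2))) :
  forall T : R, 0 < T ->
  exists h0 CT : R, [/\ 0 < h0, 0 < CT &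
    forall eps h : R, 0 < eps <= eps0 -> 0 < h <= h0 ->
      (* the inverses in the definition of the step exist *)
      (forall k : R * R, k \in K ->
         Pstar_den h (matA ax ay (dsym k.1) (dsym k.2)) (matB cx cy eps)
           \in unitmx /\
         S_den h (matA ax ay (dsym k.1) (dsym k.2)) (matB cx cy eps)
           \in unitmx) /\
      forall (U0 : R * R -> 'cV[R[i]]_3) (n : nat), n%:R * h <= T ->
        grid_norm K (fun k =>
          R_SFRC ax ay cx cy h eps (dsym k.1) (dsym k.2) ^+ n *m U0 k
          - expmx ((n%:R * h)%:C *: matL ax ay cx cy eps (dsym k.1) (dsym k.2))
              *m U0 k)
        <= CT * h ^+ 4 * grid_norm K U0].
Proof.
move=> T T_gt0; have [gam gam_gt0 zeta_ge] := hzeta.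
have mode k : exists C : R, k \in K -> 0 <= C /\
    forall eps h, 0 < eps <= eps0 -> 0 < h <= 1 ->
      (Pstar_den h (matA ax ay (dsym k.1) (dsym k.2)) (matB cx cy eps) \in unitmx /\
       S_den h (matA ax ay (dsym k.1) (dsym k.2)) (matB cx cy eps) \in unitmx) /\
      forall (v : 'cV[R[i]]_3) (n : nat), n%:R * h <= T ->
        enorm (R_SFRC ax ay cx cy h eps (dsym k.1) (dsym k.2) ^+ n *m v
          - expmx ((n%:R * h)%:C *: matL ax ay cx cy eps (dsym k.1) (dsym k.2)) *m v)
        <= C * h ^+ 4 * enorm v.
  have [kK|//] := boolP (k \in K); last by exists 0.
  have [C C0 HC] := mode_error heps0 gam_gt0 T_gt0
    (fun eps eps_itv => zeta_ge eps k eps_itv kK).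
  by exists C.
have [C HC] := choice mode.
(* the sum dominates each constant; adding 1 keeps it positive on the empty grid *)
pose CT := 1 + \sum_(k <- K) C k.
have C_le k : k \in K -> C k <= CT.
  move=> kK; rewrite /CT (big_rem k)//= addrCA lerDl addr_ge0// big_seq.
  by apply: sumr_ge0 => j /mem_rem/HC[].
have CT_gt0 : 0 < CT.
  by rewrite ltr_pwDl// big_seq; apply: sumr_ge0 => k /HC[].
exists 1, CT; split => // eps h eps_itv h_itv; split => [k /HC[_]|U0 n nhT].
  by move=> /(_ _ _ eps_itv h_itv)[].
have h_ge0 : 0 <= h by case/andP: h_itv => /ltW.
have b0 : 0 <= CT * h ^+ 4 by rewrite mulr_ge0 ?exprn_ge0// ltW.
rewrite /grid_norm -[X in _ <= X * _](ger0_norm b0) -sqrtr_sqr -sqrtrM ?sqr_ge0//.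
apply: ler_wsqrtr; rewrite mulr_sumr big_seq [leRHS]big_seq.
apply: ler_sum => k kK; rewrite -exprMn; apply: lerXn2r.
- exact: sqrtr_ge0.
- exact: mulr_ge0 b0 (sqrtr_ge0 _).
have [_ /(_ _ _ eps_itv h_itv)[_ /(_ (U0 k) n nhT)]] := HC k kK.
move=> Hk; apply: le_trans Hk _; apply: ler_wpM2r; first exact: sqrtr_ge0.
by apply: ler_wpM2r; [exact: exprn_ge0|exact: C_le].
Qed.
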